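(* Let $Q_1$ and $Q_2$ be finite directed graphs. The algebras $GC^*_m(Q_1)$ and $GC^*_m(Q_2)$ are isomorphic as Banach algebras if and only if the undirected graphs $\widehat{Q_1}$ and $\widehat{Q_2}$ are isomorphic.
   Context: A directed graph $Q$ has vertex set $V(Q)$, edge set $E(Q)$ and range and source maps $r,s:E(Q)\to V(Q)$; it is finite if $V(Q)$ and $E(Q)$ are finite. Loops and multiple edges are allowed. The universal $C^*$-algebra $GC^*_m(Q)$ of $Q$ is the universal $C^*$-algebra generated by projections $P_v$ ($v\in V(Q)$) and contractions $T_e$ ($e\in E(Q)$) satisfying $P_{r(e)}T_e=T_e=T_eP_{s(e)}$ for all $e\in E(Q)$ (the projections $P_v$ for distinct $v$ are not required to be orthogonal). Equivalently, $GC^*_m(Q)$ is the maximal $C^*$-algebra $C^*_m(OA(Q))$ of the universal operator algebra $OA(Q)$ of $Q$, where $OA(Q)$ is the universal norm closed operator algebra generated by such projections and contractions. An isomorphism of Banach algebras is a bounded algebra isomorphism with bounded inverse (not necessarily isometric or $*$-preserving). For a directed graph $Q$, $\widehat{Q}$ is the undirected graph obtained by forgetting the directions of the edges: its vertex set is $V(Q)$, and for each pair $\{v,w\}$ of vertices ($v=w$ allowed) its number of edges $n(\{v,w\})$ joining $v$ and $w$ is the number of $e\in E(Q)$ with $\{r(e),s(e)\}=\{v,w\}$. An isomorphism $\widehat{Q_1}\to\widehat{Q_2}$ is a bijection of vertex sets preserving the numbers $n(\{v,w\})$. *)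

(* Defs.v *)
From HB Require Import structures.
From mathcomp Require Import all_boot all_order all_algebra.
From mathcomp Require Import complex.
From mathcomp Require Import all_classical all_reals all_analysis.

Set Implicit Arguments.
Unset Strict Implicit.
Unset Printing Implicit Defensive.

Import Order.TTheory GRing.Theory Num.Theory.
Import numFieldNormedType.Exports.

Local Open Scope classical_set_scope.
Local Open Scope ring_scope.
Local Open Scope complex_scope.

(* Algebras are not assumed unital, so the product is not inherited from
   MathComp's rings, which all have a unit.  Norms take their values in the
   nonnegative reals inside R[i]. *)
HB.mixin Record isBanachAlgebra (R : realType) A
    of CompleteNormedModule R[i] A := {
  bmul : A -> A -> A;
  bmulA : associative bmul;
  bmulDl : left_distributive bmul +%R;
  bmulDr : right_distributive bmul +%R;
  bmulZl : forall (a : R[i]) (x y : A), bmul (a *: x) y = a *: bmul x y;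
  bmulZr : forall (a : R[i]) (x y : A), bmul x (a *: y) = a *: bmul x y;
  normr_bmul : forall x y : A, `|bmul x y| <= `|x| * `|y|
}.

#[short(type="banachAlgType")]
HB.structure Definition BanachAlgebra (R : realType) :=
  {A of isBanachAlgebra R A & CompleteNormedModule R[i] A}.

HB.mixin Record isCStarAlgebra (R : realType) A of BanachAlgebra R A := {
  star : A -> A;
  starK : involutive star;
  starD : {morph star : x y / x + y};
  starZ : forall (a : R[i]) (x : A), star (a *: x) = (Num.conj a) *: star x;
  starM : forall x y : A, star (bmul x y) = bmul (star y) (star x);
  normr_star_bmul : forall x : A, `|bmul (star x) x| = `|x| ^+ 2
}.

#[short(type="cstarAlgType")]
HB.structure Definition CStarAlgebra (R : realType) :=
  {A of isCStarAlgebra R A & BanachAlgebra R A}.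

Section BanachIsomorphism.
Variable R : realType.

Definition bounded_map (A B : banachAlgType R) (f : A -> B) : Prop :=
  exists M : R[i], forall x : A, `|f x| <= M * `|x|.

Definition banach_isomorphic (A B : banachAlgType R) : Prop :=
  exists (f : {linear A -> B}) (g : B -> A),
    [/\ {morph f : x y / bmul x y}, cancel f g, cancel g f,
        bounded_map f & bounded_map g].

End BanachIsomorphism.

Record digraph := Digraph {
  vertex : finType;
  edge : finType;
  range_map : edge -> vertex;
  source_map : edge -> vertex
}.

(* An undirected graph with loops and multiple edges, up to the names of its
   edges: mult [set v; w] is the number of edges joining v and w.  Sets that
   are not of the form [set v; w] carry no edge. *)
Record multigraph := Multigraph {
  node : finType;
  mult : {set node} -> nat;
  mult_pair : forall A : {set node}, (0 < mult A)%N ->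
    exists v w, A = [set v; w]%SET
}.

Definition edges_between (Q : digraph) (A : {set vertex Q}) : nat :=
  #|[set e : edge Q | [set range_map e; source_map e] == A]%SET|.

Lemma edges_between_pair (Q : digraph) (A : {set vertex Q}) :
  (0 < edges_between A)%N -> exists v w, A = [set v; w]%SET.
Proof.
case/card_gt0P => e; rewrite inE => /eqP <-.
by exists (range_map e), (source_map e).
Qed.

Definition undirected (Q : digraph) : multigraph :=
  Multigraph (@edges_between_pair Q).

Definition multigraph_isomorphic (G H : multigraph) : Prop :=
  exists2 f : node G -> node H, bijective f &
    forall v w : node G,
      mult [set v; w]%SET = mult [set f v; f w]%SET.

Section UniversalAlgebra.
Variables (R : realType) (Q : digraph).

Definition projection (A : cstarAlgType R) (p : A) : Prop :=
  bmul p p = p /\ star p = p.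

Definition graph_family (A : cstarAlgType R)
    (P : vertex Q -> A) (T : edge Q -> A) : Prop :=
  [/\ forall v, projection (P v),
      forall e, `|T e| <= 1,
      forall e, bmul (P (range_map e)) (T e) = T e &
      forall e, bmul (T e) (P (source_map e)) = T e].

Definition star_morphism (A B : cstarAlgType R) (f : {linear A -> B}) : Prop :=
  {morph f : x y / bmul x y} /\ {morph f : x / star x}.

Definition cstar_subalgebra (A : cstarAlgType R) (S : set A) : Prop :=
  [/\ closed S, S 0,
      forall (a : R[i]) x y, S x -> S y -> S (a *: x + y),
      forall x y, S x -> S y -> S (bmul x y) &
      forall x, S x -> S (star x)].

Definition cstar_generated (A : cstarAlgType R) (G : set A) : Prop :=
  forall S : set A, cstar_subalgebra S -> G `<=` S -> S = setT.

(* A is the universal C*-algebra of Q; the universal property determines it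
   up to *-isomorphism.  By generation, the morphism below is unique.
   Morphisms need not preserve units. *)
Definition is_GCm (A : cstarAlgType R) : Prop :=
  exists (P : vertex Q -> A) (T : edge Q -> A),
    [/\ graph_family P T,
        cstar_generated (range P `|` range T) &
        forall (B : cstarAlgType R) (P' : vertex Q -> B) (T' : edge Q -> B),
          graph_family P' T' ->
          exists f : {linear A -> B},
            [/\ star_morphism f, forall v, f (P v) = P' v &
                forall e, f (T e) = T' e]].

End UniversalAlgebra.

(* Main.v *)
From HB Require Import structures.
Require Import Defs.
From mathcomp Require Import all_boot all_order all_algebra all_fingroup.
From mathcomp Require Import complex.
From mathcomp Require Import all_classical all_reals all_analysis.
From mathcomp Require Import ring lra zify.

(* Multigraph isomorphism gives algebra isomorphism because reversing an edge
   amounts to replacing its contraction by the adjoint.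

   For the converse, the characters of the universal algebra of Q are the pairs
   (S, z) with S a set of vertices (where the projections are 1) and z a point
   of the closed polydisc indexed by the edges with both ends in S.  A character
   of a C*-algebra is automatically contractive and *-preserving, so an algebra
   isomorphism induces homeomorphisms of these character spaces, hence a
   bijection sigma between the sets of vertices, and homeomorphisms between the
   polydiscs of S and of sigma(S).  By invariance of dimension S and sigma(S)
   span equally many edges.  For disjoint S and S', a path of representations on
   C^2 joins the sum of the characters of S and S' to the sum of those of their
   union and of the empty set; the trace of an idempotent is constant along it,
   so sigma preserves disjoint unions and comes from a bijection of vertices.
   The edges spanned by one and by two vertices then determine the multigraph.

   Invariance of dimension: a continuous injection of the m-cube into R^n with
   n < m would pull back an (n+1)-colouring of R^n by small separated bricks to
   a colouring of the m-cube whose monochromatic pieces never join opposite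
   faces, against a discrete Poincare-Miranda theorem. *)

(** The universal property yields *-morphisms without any estimate, so every closure or continuity
    argument rests on a bound that is the same for all *-morphisms. Any constant will do, and one is
    extracted from resolvents averaged over roots of unity. Generators that vary continuously then
    give a norm-continuous family of representations; this makes both the paths of representations
    and the coordinates of pulled-back characters continuous.

    Pulling characters back only yields a bijection between power sets, which need not come from a
    bijection of vertices: the polydiscs of S, of S' and of their union are separate components, and
    characters alone do not relate them. Representations on C^2 do, because projections of distinct
    vertices need not be orthogonal, so equal projections can be rotated into orthogonal ones. The
    edges can be sent to 0 along the way. *)

Set Implicit Arguments.
Unset Strict Implicit.
Unset Printing Implicit Defensive.

Import Order.TTheory GRing.Theory Num.Theory.
Import numFieldNormedType.Exports.

Local Open Scope classical_set_scope.
Local Open Scope ring_scope.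
Local Open Scope complex_scope.

(** * A discrete Poincare-Miranda theorem *)

Section Sperner.
Variable k : nat.

(* The j-th vertex of the simplex of Kuhn's triangulation of the unit cube at y
   in which the direction i is taken at step s i. *)
Definition kuhn_vertex m (y : {ffun 'I_m -> nat}) (s : 'S_m) (j : nat) :
  {ffun 'I_m -> nat} := [ffun i => (y i + (s i < j))%N].

(** Modelled on the label [least i at which f i fails, or m if there is none], for predicates such
    that f i fails on the face y i = 0 and holds on the opposite face. *)
Definition sperner_labelling m (l : {ffun 'I_m -> nat} -> nat) : Prop :=
  forall y : {ffun 'I_m -> nat}, (forall i, y i <= k)%N ->
  (l y <= m)%N /\
  forall i, (y i = 0%N -> (l y <= i)%N) /\ (y i = k -> l y != i).

(** The determinant is 1 if the p vertices carry the labels 0, ..., p-1, each once, and 0 otherwise: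
    rainbow simplices are counted modulo 2 by a sum of determinants. *)
Definition label_mx m p (l : {ffun 'I_m -> nat} -> nat)
    (v : 'I_p -> {ffun 'I_m -> nat}) : 'M['F_2]_p :=
  \matrix_(i, j) (l (v j) == i)%:R.

Lemma addrr_F2 (x : 'F_2) : x + x = 0.
Proof. by case: x => [[|[|x]] hx] //; apply: val_inj. Qed.

Lemma det_row0 (R : comNzRingType) p (A : 'M[R]_p) i :
  (forall j, A i j = 0) -> \det A = 0.
Proof. by move=> A0; rewrite (expand_det_row _ i) big1// => j _; rewrite A0 mul0r. Qed.

(* Over F_2, a labelled simplex is rainbow iff the number of its rainbow facets
   is odd: add all rows to the last one, which becomes constant 1. *)
Lemma det_label_facets m p (l : {ffun 'I_m -> nat} -> nat)
    (v : 'I_p.+1 -> {ffun 'I_m -> nat}) : (forall j, l (v j) <= p)%N ->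
  \det (label_mx l v) = \sum_(j < p.+1) \det (label_mx l (fun t => v (lift j t))).
Proof.
move=> lp; pose L : 'M['F_2]_p.+1 :=
  \matrix_(i, j) if i == ord_max then 1 else (i == j)%:R.
have dL : \det L = 1.
  rewrite (expand_det_col _ ord_max) big_ord_recr/= big1 => [|i _]; last first.
    by rewrite mxE -val_eqE/= !ltn_eqF ?mul0r// -val_eqE /= ltn_eqF.
  rewrite mxE eqxx mul1r add0r /cofactor -signr_odd addnn odd_double mul1r.
  suff -> : row' ord_max (col' ord_max L) = 1%:M by rewrite det1.
  apply/matrixP => i j; rewrite !mxE (inj_eq lift_inj).
  by rewrite -val_eqE /= /bump leqNgt ltn_ord add0n ltn_eqF.
have -> : \det (label_mx l v) = \det (L *m label_mx l v).
  by rewrite det_mulmx dL mul1r.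
have LE j : (L *m label_mx l v) ord_max j = 1.
  rewrite !mxE (bigD1 (inord (l (v j))))//= big1 => [|i ij]; rewrite !mxE eqxx mul1r.
    by rewrite inordK ?eqxx ?addr0// ltnS.
  by case: eqP => // E; move: ij; rewrite E inord_val eqxx.
rewrite (expand_det_row _ ord_max); apply: eq_bigr => j _.
rewrite LE mul1r /cofactor.
have -> : (-1) ^+ (@ord_max p + j) = 1 :> 'F_2 by rewrite (_ : -1 = 1) ?expr1n //; apply: val_inj.
rewrite mul1r; congr (\det _); apply/matrixP => i i'; rewrite !mxE.
rewrite (bigD1 (lift ord_max i))//= big1 => [|t ti]; rewrite !mxE.
  by rewrite eq_sym (negbTE (neq_lift _ _)) eqxx mul1r addr0 lift_max.
rewrite eq_sym (negbTE (neq_lift _ _)) eq_sym (negbTE ti) mul0r //.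
Qed.

(* Exchanging the directions taken at steps j-1 and j gives the other simplex
   with the same j-th facet. *)
Lemma facet_swap m (l : {ffun 'I_m -> nat} -> nat) (y : {ffun 'I_m -> nat})
    (j : 'I_m.+1) : (0 < j < m)%N ->
  \sum_(s : 'S_m) \det (label_mx l (fun t : 'I_m => kuhn_vertex y s (lift j t))) = 0.
Proof.
case: m l y j => [|m] l y j; first by rewrite ltn0 andbF.
case/andP => j0 jm; pose a : 'I_m.+1 := inord j.-1; pose b : 'I_m.+1 := inord j.
have va : a = j.-1 :> nat by rewrite inordK// prednK// ltnW.
have vb : b = j :> nat by rewrite inordK.
have ab : a != b by rewrite -val_eqE /= va vb; case: (nat_of_ord j) j0 => // n _; rewrite neq_ltn /= ltnSn.
pose G (s : 'S_m.+1) := \det (label_mx l (fun t : 'I_m.+1 => kuhn_vertex y s (lift j t))).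
have GE s : G (s * tperm a b)%g = G s.
  congr (\det _); apply/matrixP => i t; rewrite !mxE /=.
  congr ((l _ == _)%:R); apply/ffunP => e; rewrite !ffunE permM; congr (_ + nat_of_bool _)%N.
  have jt : bump j t != j by rewrite eq_sym neq_bump.
  have E : (j.-1 < bump j t)%N = (j < bump j t)%N.
    by rewrite prednK// [RHS]ltn_neqAle eq_sym jt.
  by case: tpermP => [->|->|_ _ //]; rewrite va vb E.
rewrite (bigID (fun s : 'S_m.+1 => odd_perm s))/=.
suff -> : \sum_(s : 'S_m.+1 | odd_perm s) G s = \sum_(s | ~~ odd_perm s) G s.
  exact: addrr_F2.
rewrite (reindex_inj (mulIg (tperm a b)))/=; apply: eq_big => [s|s _]; last exact: GE.
by rewrite odd_permM odd_tperm ab addbT.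
Qed.

Lemma reindex_lift_perm (V : nmodType) m (F : 'S_m.+1 -> V) :
  \sum_(s : 'S_m.+1 | s ord_max == ord_max) F s =
  \sum_(s : 'S_m) F (lift_perm ord_max ord_max s).
Proof.
pose u (s : 'S_m.+1) i := odflt i (unlift (s ord_max) (s (lift ord_max i))).
have uK (s : 'S_m.+1) i : lift (s ord_max) (u s i) = s (lift ord_max i).
  rewrite /u; case: unliftP => //= /perm_inj/eqP.
  by rewrite eq_sym (negbTE (neq_lift _ _)).
have u_inj s : injective (u s).
  move=> i j uij; have := uK s i; rewrite uij uK => /perm_inj E.
  exact: (lift_inj (esym E)).
rewrite (reindex (lift_perm ord_max ord_max)).
  by apply: eq_bigl => s; rewrite lift_perm_id eqxx.
exists (fun s => perm (u_inj s)) => [s _|s].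
  by apply/permP => i; rewrite permE /u lift_perm_lift lift_perm_id liftK.
move=> /eqP sm; apply/permP => i; case: (unliftP ord_max i) => [j|] -> {i}.
  by rewrite lift_perm_lift permE -uK sm.
by rewrite lift_perm_id sm.
Qed.

Definition ffun_val m (x : {ffun 'I_m -> 'I_k}) : {ffun 'I_m -> nat} :=
  [ffun i => x i : nat].

Definition ffun_incr m (d : 'I_m) (y : {ffun 'I_m -> nat}) : {ffun 'I_m -> nat} :=
  [ffun i => (y i + (i == d))%N].

(** A bijective stand-in for [ffun_incr d]: the two differ only on the last layer of cubes in
    direction d, where [x d = k.-1]. *)
Definition ffun_rot m (d : 'I_m) (x : {ffun 'I_m -> 'I_k}) : {ffun 'I_m -> 'I_k} :=
  [ffun i => if i == d then ordS (x i) else x i].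

Lemma ffun_rot_inj m (d : 'I_m) : injective (ffun_rot d).
Proof.
move=> x x' /ffunP E; apply/ffunP => i; have := E i; rewrite !ffunE.
by case: eqP => // _; apply: ordS_inj.
Qed.

(* Dropping the first vertex of one simplex is dropping the last vertex of the
   adjacent one, translated by e_d and with its directions shifted cyclically. *)
Lemma facet_first m (l : {ffun 'I_m.+1 -> nat} -> nat) (y : {ffun 'I_m.+1 -> nat}) :
  \sum_(s : 'S_m.+1) \det (label_mx l (fun t : 'I_m.+1 => kuhn_vertex y s (lift (ord0 : 'I_m.+2) t))) =
  \sum_(s : 'S_m.+1)
    \det (label_mx l (fun j : 'I_m.+1 =>
                        kuhn_vertex (ffun_incr (s^-1%g ord_max) y) s j)).
Proof.
rewrite (reindex_inj (mulIg (perm (@ordS_inj m.+1)))).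
apply: eq_bigr => s _; congr (\det _); apply/matrixP => i j; rewrite !mxE/=.
congr ((l _ == _)%:R); apply/ffunP => e; rewrite !ffunE permM permE -addnA.
congr (_ + _)%N; rewrite /= /bump add1n.
have [->|ed] := eqVneq e (s^-1%g ord_max).
  by rewrite permKV /= modnn [(m < j)%N]leqNgt ltn_ord.
have sem : (s e < m)%N.
  rewrite ltn_neqAle -ltnS ltn_ord andbT; apply: contraNneq ed => sem.
  by apply/eqP/(@perm_inj _ s); rewrite permKV; apply: val_inj.
by rewrite modn_small.
Qed.

(** Induction on the dimension. Determinants are expanded along facets; inner facets cancel by
    [facet_swap], first and last ones between adjacent cubes. The survivors lie on the two faces
    orthogonal to the last direction d of s, and the labels rule out a rainbow facet there except on
    the face where the last coordinate is 0, itself a labelled cube of lower dimension. *)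
Theorem sperner m (l : {ffun 'I_m -> nat} -> nat) : (0 < k)%N ->
  sperner_labelling l ->
  \sum_(x : {ffun 'I_m -> 'I_k}) \sum_(s : 'S_m)
     \det (label_mx l (fun j : 'I_m.+1 => kuhn_vertex (ffun_val x) s j)) = 1.
Proof.
move=> k0; elim: m l => [|m IH] l lS.
  have x0 : {ffun 'I_0 -> 'I_k} by apply: [ffun i => Ordinal k0].
  rewrite (big_pred1 x0); last by move=> x; apply/esym/eqP/ffunP => -[].
  rewrite (big_pred1 1%g); last by move=> s; apply/esym/eqP/permP => -[].
  rewrite (expand_det_row _ ord0) big_ord1 mxE /cofactor det_mx00 expr0.
  have l0 : (l (kuhn_vertex (ffun_val x0) 1 ord0) <= 0)%N.
    by have [|l0 _] := lS (kuhn_vertex (ffun_val x0) 1 (ord0 : 'I_1)); first by case.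
  by rewrite -leqn0 l0 !mulr1.
have bd (x : {ffun 'I_m.+1 -> 'I_k}) s j i :
    (kuhn_vertex (ffun_val x) s j i <= k)%N.
  by rewrite !ffunE; case: (_ < _)%N; rewrite ?addn0 ?addn1 // ltnW.
pose H y s := \det (label_mx l (fun j : 'I_m.+1 => kuhn_vertex y s j)).
transitivity (\sum_(x : {ffun 'I_m.+1 -> 'I_k}) \sum_(s : 'S_m.+1)
   (H (ffun_incr (s^-1%g ord_max) (ffun_val x)) s + H (ffun_val x) s)).
  apply: eq_bigr => x _.
  under eq_bigr => s _.
    rewrite det_label_facets => [|j]; last by have [] := lS _ (bd x s j).
    over.
  rewrite exchange_big big_ord_recl big_ord_recr /=.
  rewrite facet_first big_split /=; congr (_ + _).
  rewrite big1 ?add0r => [|i _].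
    apply: eq_bigr => s _; congr (\det _); apply/matrixP => i j; rewrite !mxE.
    by rewrite {2}/bump add1n /bump [(m < j)%N]leqNgt ltn_ord.
  apply: (@facet_swap _ _ _ (lift ord0 (widen_ord (leqnSn m) i))).
  by rewrite /= /bump /= add1n ltnS ltn_ord.
rewrite exchange_big /=.
pose m1 : 'I_m.+1 := ord_max.
have row0 y s (i : 'I_m.+1) : (forall j : 'I_m.+1, l (kuhn_vertex y s j) != i) -> H y s = 0.
  by move=> li; apply: (@det_row0 _ _ _ i) => j; rewrite mxE (negbTE (li j)).
have HE (s : 'S_m.+1) : let d := s^-1%g ord_max in
    \sum_(x : {ffun 'I_m.+1 -> 'I_k}) (H (ffun_incr d (ffun_val x)) s + H (ffun_val x) s) =
    if d == m1 then \sum_(x : {ffun 'I_m.+1 -> 'I_k} | x m1 == k.-1 :> nat)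
      H (ffun_val (ffun_rot m1 x)) s else 0.
  move=> d; have sd : s d = ord_max by rewrite permKV.
  rewrite big_split /= [X in _ + X](reindex_inj (@ffun_rot_inj m.+1 d)) -big_split /=.
  rewrite (bigID (fun x : {ffun 'I_m.+1 -> 'I_k} => x d == k.-1 :> nat)) /=.
  rewrite [X in _ + X]big1 => [|x xd]; last first.
    rewrite (_ : ffun_incr d (ffun_val x) = ffun_val (ffun_rot d x)) ?addrr_F2 //.
    apply/ffunP => i; rewrite !ffunE; case: eqVneq => [->|]; rewrite ?addn0 //=.
    rewrite modn_small ?addn1 // ltn_neqAle ltn_ord andbT.
    by apply: contraNneq xd => /(congr1 predn) /= ->.
  rewrite addr0.
  transitivity (\sum_(x : {ffun 'I_m.+1 -> 'I_k} | x d == k.-1 :> nat)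
      H (ffun_val (ffun_rot d x)) s).
    (* This facet lies on the face [y d = k], where the label d does not occur. *)
    apply: eq_bigr => x /eqP xd; rewrite (row0 _ _ d) ?add0r // => j.
    have [i|_ /(_ d)[_ ]] := lS (kuhn_vertex (ffun_incr d (ffun_val x)) s j).
      rewrite !ffunE; case: (eqVneq i d) => [->|_].
        by rewrite sd xd addn1 prednK // [(_ < j)%N]leqNgt ltn_ord addn0.
      by rewrite addn0; case: (_ < _)%N; rewrite ?addn0 ?addn1 // ltnW.
    apply; rewrite !ffunE eqxx sd xd addn1 prednK // [(_ < j)%N]leqNgt ltn_ord.
    by rewrite addn0.
  (* This facet lies on the face [y d = 0], where labels are at most d, so for d < m the label m is
     missing. *)
  case: eqVneq => [-> //|dm]; apply: big1 => x /eqP xd.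
  apply: (row0 _ _ m1) => j.
  have [_ /(_ d)[+ _]] := lS _ (bd (ffun_rot d x) s j).
  rewrite !ffunE eqxx sd /= xd prednK // modnn add0n [(_ < j)%N]leqNgt ltn_ord.
  move=> /(_ erefl) ld; rewrite neq_ltn (leq_ltn_trans ld) //.
  by rewrite ltn_neqAle dm -ltnS ltn_ord.
under eq_bigr => s _ do rewrite HE.
rewrite -big_mkcond /=.
under eq_bigl => s.
  rewrite (can2_eq (permKV s) (permK s)) eq_sym.
  over.
rewrite reindex_lift_perm.
pose ext (y : {ffun 'I_m -> nat}) : {ffun 'I_m.+1 -> nat} :=
  [ffun i => if unlift ord_max i is Some i' then y i' else 0%N].
have extS : sperner_labelling (l \o ext).
  move=> y yk; have [i|_ L] := lS (ext y).
    by rewrite ffunE; case: unliftP => // j _; apply: yk.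
  split=> [|i].
    by have [+ _] := L ord_max; apply; rewrite ffunE unlift_none.
  have := L (lift ord_max i); rewrite lift_max ffunE liftK; exact.
rewrite -(IH _ extS) [RHS]exchange_big /=; apply: eq_bigr => s _.
have k1 : (k.-1 < k)%N by rewrite prednK.
pose ins (x : {ffun 'I_m -> 'I_k}) : {ffun 'I_m.+1 -> 'I_k} :=
  [ffun i => if unlift ord_max i is Some i' then x i' else Ordinal k1].
pose res (x : {ffun 'I_m.+1 -> 'I_k}) : {ffun 'I_m -> 'I_k} :=
  [ffun i => x (lift ord_max i)].
rewrite (reindex_onto ins res) /= => [|x /eqP xm]; last first.
  apply/ffunP => i; rewrite !ffunE; case: unliftP => [j|] -> //.
    by rewrite ffunE.
  exact: val_inj.
apply: eq_big => [x|x _].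
  rewrite ffunE unlift_none eqxx; apply/eqP/ffunP => i.
  by rewrite !ffunE liftK.
congr (\det _); apply/matrixP => i j; rewrite !mxE /=.
congr ((l _ == _)%:R); apply/ffunP => e; rewrite !ffunE.
case: (unliftP ord_max e) => [e'|] ->.
  by rewrite lift_perm_lift lift_max !ffunE eq_sym (negbTE (neq_lift _ _)).
rewrite eqxx lift_perm_id /= prednK // modnn add0n.
by rewrite [(_ < j)%N]leqNgt ltn_ord.
Qed.

End Sperner.

(** A rainbow simplex for [l] lies in one small cube: f i fails at its vertex labelled i, and every
    f i holds at its vertex labelled m. *)
Lemma poincare_miranda_cube k m (f : 'I_m -> {ffun 'I_m -> nat} -> bool) :
  (0 < k)%N ->
  (forall i (y : {ffun 'I_m -> nat}), (forall j, y j <= k)%N -> y i = 0%N -> ~~ f i y) ->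
  (forall i (y : {ffun 'I_m -> nat}), (forall j, y j <= k)%N -> y i = k -> f i y) ->
  exists x : {ffun 'I_m -> nat}, (forall j, x j < k)%N /\
    forall i, exists y z : {ffun 'I_m -> nat},
      [/\ forall j, (x j <= y j <= (x j).+1)%N,
          forall j, (x j <= z j <= (x j).+1)%N, ~~ f i y & f i z].
Proof.
move=> k0 f0 fk.
pose l y := find (fun i => ~~ f i y) (enum 'I_m).
have lle y (i : 'I_m) : ~~ f i y -> (l y <= i)%N.
  move=> fi; rewrite leqNgt; apply/negP => /(before_find i).
  by rewrite nth_ord_enum fi.
have lf y (i : 'I_m) : l y = i -> ~~ f i y.
  move=> li; have h : has (fun i => ~~ f i y) (enum 'I_m).
    by rewrite has_find -/(l y) li size_enum_ord.
  by have := nth_find i h; rewrite -/(l y) li nth_ord_enum.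
have lS : sperner_labelling k l.
  move=> y yk; split=> [|i]; first by rewrite -[m in leqRHS]size_enum_ord find_size.
  split=> yi; first by apply: lle; apply: f0.
  by apply: contraPneq (fk _ _ yk yi) => /lf /negP.
have := sperner k0 lS; have [[x [s xs]] _|no] :=
  pselect (exists x : {ffun 'I_m -> 'I_k}, exists s : 'S_m,
    \det (label_mx l (fun j : 'I_m.+1 => kuhn_vertex (ffun_val x) s j)) != 0); last first.
  rewrite big1 => [/eqP|x _]; first by rewrite eq_sym oner_eq0.
  by apply: big1 => s _; apply/eqP/negPn/negP => xs; apply: no; exists x, s.
have lab (i : 'I_m.+1) : exists j, l (kuhn_vertex (ffun_val x) s j) = i.
  apply: contrapT => /forallNP ni; move/negP: xs; apply; apply/eqP.
  by apply: (@det_row0 _ _ _ i) => j; rewrite mxE; case: eqP => // /ni.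
have cube j i : (ffun_val x i <= kuhn_vertex (ffun_val x) s j i <= (ffun_val x i).+1)%N.
  by rewrite !ffunE; case: (_ < _)%N; rewrite ?addn0 ?addn1 !leqnn leqnSn.
exists (ffun_val x); split=> [j|i]; first by rewrite ffunE.
have [jy Ey] := lab (widen_ord (leqnSn m) i); have [jz Ez] := lab ord_max.
exists (kuhn_vertex (ffun_val x) s jy), (kuhn_vertex (ffun_val x) s jz); split=> //.
  exact: lf.
by apply: contraT => /lle; rewrite Ez leqNgt ltn_ord.
Qed.

(** * Invariance of dimension *)

(* The cubes of side < 1 of colour j are the cells of the integer lattice
   shifted by j/(n+1), thinned near their walls: a coordinate of a point is
   close to at most one of the n+1 shifted lattices, so the n coordinates leave
   some colour free. *)
Lemma brick_colouring (R : realType) n : exists2 d : R, 0 < d &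
  exists (good : 'I_n.+1 -> 'rV[R]_n -> Prop)
         (piece : 'I_n.+1 -> 'rV[R]_n -> {ffun 'I_n -> int}),
  [/\ forall u, exists j, good j u,
      forall j u u', good j u -> good j u' ->
        (forall i, `|u 0 i - u' 0 i| < d) -> piece j u = piece j u' &
      forall j u u', piece j u = piece j u' -> forall i, `|u 0 i - u' 0 i| < 1].
Proof.
pose q : R := n.+1%:R; have q0 : 0 < q by rewrite ltr0n.
pose c (j : 'I_n.+1) : R := j%:R / q.
(* Distinct shifts differ by at least 1 / q modulo 1, and 2 e = 1 / (2 q), so no coordinate is
   within e of two shifted lattices. *)
pose e : R := (4 * q)^-1; have e0 : 0 < e by rewrite invr_gt0 mulr_gt0.
pose good j (u : 'rV[R]_n) := forall i (z : int), e <= `|u 0 i - c j - z%:~R|.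
pose piece j (u : 'rV[R]_n) := [ffun i => Num.floor (u 0 i - c j)].
exists (2 * e); first by rewrite mulr_gt0.
exists good, piece; split.
- move=> u; apply: contrapT => /forallNP bad.
  have {}bad j : exists iz : 'I_n * int, `|u 0 iz.1 - c j - iz.2%:~R| < e.
    have /existsNP[i /existsNP[z /negP]] := bad j.
    by rewrite -ltNge; exists (i, z).
  have [g gP] := choice bad.
  suff /leq_card : injective (fun j => (g j).1) by rewrite !card_ord ltnn.
  move=> j j' gjj; have := gP j'; have := gP j; rewrite gjj.
  move: (g j).2 (g j').2 (u 0 _) => z z' x h h'.
  have : `|(j%:R - j'%:R) / q + (z - z')%:~R| < 2 * e.
    rewrite [X in `|X|](_ : _ = (x - c j' - z'%:~R) - (x - c j - z%:~R)); last first.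
      by rewrite intrB mulrBl -/(c j) -/(c j'); ring.
    by rewrite (le_lt_trans (ler_normB _ _)) // mulr_natl mulr2n ltrD.
  rewrite -(ltr_pM2r q0) -[X in _ * X < _](gtr0_norm q0) -normrM mulrDl mulfVK ?gt_eqF //.
  have -> : 2 * e * q = 2^-1 by rewrite /e invfM mulrA -mulrA mulVf ?gt_eqF//; lra.
  have -> : j%:R - j'%:R + (z - z')%:~R * q = ((j : int) - (j' : nat)%:Z + (z - z') * n.+1)%:~R :> R.
    by rewrite [RHS]intrD intrM !intrB.
  rewrite -intr_norm => jj; have : `|(j : int) - (j' : nat)%:Z + (z - z') * n.+1| < 1.
    by rewrite -(ltr_int R); lra.
  move=> jz; apply: val_inj => /=; have := ltn_ord j; have := ltn_ord j'.
  move: jz; move: (z - z') => w; move: (nat_of_ord j) (nat_of_ord j') => a b ab bn an.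
  have {}ab : a%:Z - b%:Z = - w * n.+1 by lia.
  have [w1|[w0|w1]] : (1 <= w)%R \/ w = 0 \/ (w <= -1)%R by lia.
  - nia.
  - by subst w; lia.
  - nia.
- move=> j u u' gu gu' uu'; apply/ffunP => i; rewrite !ffunE.
  have lt (a b : 'rV[R]_n) : good j a -> good j b -> `|a 0 i - b 0 i| < 2 * e ->
      (Num.floor (a 0 i - c j) <= Num.floor (b 0 i - c j))%R.
    move=> ga gb ab; rewrite leNgt; apply/negP => fl.
    set f := Num.floor (a 0 i - c j) in fl.
    have fa : f%:~R <= a 0 i - c j by apply: floor_le.
    have fb : b 0 i - c j < f%:~R by rewrite -floor_lt_int.
    have := ga i f; rewrite ger0_norm ?subr_ge0 // => af.
    have := gb i f; rewrite ltr0_norm ?subr_lt0 // => bf.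
    by move: ab; rewrite ltr_norml => /andP[ab1 ab2]; lra.
  apply/eqP; rewrite eq_le !lt //; first by rewrite distrC.
- move=> j u u' /ffunP E i; have := E i; rewrite !ffunE => Ei.
  have := floor_itv (u 0 i - c j); have := floor_itv (u' 0 i - c j).
  rewrite Ei intrD => /andP[a1 a2] /andP[b1 b2].
  by rewrite ltr_norml; lra.
Qed.

Lemma compact_lower_bound (T : topologicalType) (R : realType) (f : T -> R) (A : set T) :
  compact A -> continuous f -> (forall x, A x -> 0 < f x) ->
  exists2 d : R, 0 < d & forall x, A x -> d <= f x.
Proof.
move=> cA cf f0; have [->|A0] := eqVneq A set0; first by exists 1.
have [|c cA' cm] := compact_EVT_min (proj1 (set0P _) A0) cA (f := f).
  exact: continuous_subspaceT.
exists (f c) => [|x Ax]; first by apply: f0; rewrite inE in cA'.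
by apply: cm; rewrite inE.
Qed.

Lemma rV_norm_lt (R : realType) n (u : 'rV[R]_n) (e : R) :
  0 < e -> (`|u| < e) <-> (forall i, `|u 0 i| < e).
Proof.
move=> e0; have E : ball (0 : 'rV[R]_n) e u = (`|u| < e).
  by rewrite mx_norm_ball /ball_ /= sub0r normrN.
split; first by rewrite -E => -[_ ue] i; have := ue 0 i; rewrite mxE /ball /= sub0r normrN.
move=> ue; rewrite -E; split=> // i j.
by rewrite ord1 mxE /ball /= sub0r normrN.
Qed.

Section Dimension.
Variables (R : realType) (m n : nat) (h : 'rV[R]_m -> 'rV[R]_n).

Definition unit_box : set 'rV[R]_m := [set x | forall i, `[0, 1]%classic (x 0 i)].

Hypothesis h_cont : continuous h.
Hypothesis h_inj : forall x y, unit_box x -> unit_box y -> h x = h y -> x = y.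

Lemma compact_box2 : compact (unit_box `*` unit_box).
Proof.
have cB := @rV_compact R m (fun=> `[0, 1]%classic) (fun=> @segment_compact R 0 1).
by apply: compact_setX; exact: cB.
Qed.

Lemma continuous_dist_source :
  continuous (fun p : 'rV[R]_m * 'rV[R]_m => `|p.1 - p.2| : R).
Proof.
move=> p; apply: cvg_norm; apply: cvgB; [exact: cvg_fst|exact: cvg_snd].
Qed.

Lemma continuous_dist_image :
  continuous (fun p : 'rV[R]_m * 'rV[R]_m => `|h p.1 - h p.2| : R).
Proof.
move=> p; apply: cvg_norm; apply: cvgB.
  by apply: (@continuous_comp _ _ _ fst h); [exact: cvg_fst|exact: h_cont].
by apply: (@continuous_comp _ _ _ snd h); [exact: cvg_snd|exact: h_cont].
Qed.

(** On the compact set of pairs at distance at least e, the distance between the images has a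
    positive minimum. *)
Lemma box_inverse_modulus (e : R) : 0 < e -> exists2 d : R, 0 < d &
  forall x y, unit_box x -> unit_box y -> `|h x - h y| < d -> `|x - y| < e.
Proof.
move=> e0; pose C := (unit_box `*` unit_box) `&` [set p | e <= `|p.1 - p.2|].
have cC : compact C.
  apply: compact_closedI; first exact: compact_box2.
  apply: (@closed_comp _ _ _ [set r : R | e <= r]); last exact: closed_ge.
  by move=> p _; exact: continuous_dist_source.
have [|d d0 dC] := compact_lower_bound cC continuous_dist_image.
  move=> [x y] [[/= bx bY] exy]; rewrite normr_gt0 subr_eq0.
  apply: contraPneq exy => /(h_inj bx bY) ->.
  by rewrite subrr normr0 leNgt e0.
exists d => // x y bx bY; apply: contraTT; rewrite -!leNgt => exy.
exact: (dC (x, y)).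
Qed.

Lemma box_modulus (e : R) : 0 < e -> exists2 d : R, 0 < d &
  forall x y, unit_box x -> unit_box y -> `|x - y| < d -> `|h x - h y| < e.
Proof.
move=> e0; pose C := (unit_box `*` unit_box) `&` [set p | e <= `|h p.1 - h p.2|].
have cC : compact C.
  apply: compact_closedI; first exact: compact_box2.
  apply: (@closed_comp _ _ _ [set r : R | e <= r]); last exact: closed_ge.
  by move=> p _; exact: continuous_dist_image.
have [|d d0 dC] := compact_lower_bound cC continuous_dist_source.
  move=> [x y] [[/= bx bY] exy]; rewrite normr_gt0 subr_eq0.
  apply: contraPneq exy => ->.
  by rewrite subrr normr0 leNgt e0.
exists d => // x y bx bY; apply: contraTT; rewrite -!leNgt => exy.
exact: (dC (x, y)).
Qed.

Theorem invariance_of_dimension : (m <= n)%N.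
Proof.
rewrite leqNgt; apply/negP => nm.
have [d d0 [good [piece [cover sep small]]]] := brick_colouring R n.
(* With h rescaled by 1 / s, points whose images share a piece are less than 1/3 apart; r is chosen
   so that images of nearby grid points are d-close after the rescaling. *)
have [s s0 sP] : exists2 s : R, 0 < s & forall x y, unit_box x -> unit_box y ->
    `|h x - h y| < s -> `|x - y| < 3^-1 by apply: box_inverse_modulus.
have [r r0 rP] : exists2 r : R, 0 < r & forall x y, unit_box x -> unit_box y ->
    `|x - y| < r -> `|h x - h y| < d * s.
  by apply: box_modulus; rewrite mulr_gt0.
(* The 5 excludes a piece that joins opposite faces: from [w i <= 2] to [z i >= k - 1] it would give
   3 (k - 1) < 6 + k. The other summand makes two grid steps shorter than r. *)
pose k := (5 + Num.truncn (3 / r))%N.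
have k0 : 0 < k%:R :> R by rewrite ltr0n.
have kr : 2 / k%:R < r.
  rewrite ltr_pdivrMr // mulrC -ltr_pdivrMr //.
  have H : 3 / r < k%:R.
    by apply: lt_le_trans (truncnS_gt _) _; rewrite ler_nat /k -add1n leq_add2r.
  by apply: lt_trans H; rewrite ltr_pM2r ?invr_gt0 // ltr_nat.
pose pt (y : {ffun 'I_m -> nat}) : 'rV[R]_m := \row_i ((y i)%:R / k%:R).
pose grid (y : {ffun 'I_m -> nat}) := forall i, (y i <= k)%N.
have box y : grid y -> unit_box (pt y).
  move=> yk i; rewrite /= mxE in_itv /= divr_ge0 //= ler_pdivrMr // mul1r ler_nat.
  exact: yk.
pose u y := s^-1 *: h (pt y).
have uB y z i : `|u y 0 i - u z 0 i| = s^-1 * `|(h (pt y) - h (pt z)) 0 i|.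
  by rewrite !mxE -mulrBr normrM gtr0_norm // invr_gt0.
have u_close y z : grid y -> grid z -> (forall i, (y i <= z i + 2)%N /\ (z i <= y i + 2)%N) ->
    forall i, `|u y 0 i - u z 0 i| < d.
  move=> gy gz yz i; rewrite uB mulrC ltr_pdivrMr //.
  apply: (proj1 (rV_norm_lt _ _)) i; first by rewrite mulr_gt0.
  apply: rP; [exact: box|exact: box|]; apply/rV_norm_lt => // i.
  rewrite !mxE -mulrBl normrM [ `|_^-1|]gtr0_norm ?invr_gt0 //.
  apply: le_lt_trans kr; rewrite ler_pM2r ?invr_gt0 // ler_norml.
  have [] := yz i; rewrite -!(ler_nat R) !natrD; lra.
have u_far y z : grid y -> grid z -> (forall i, `|u y 0 i - u z 0 i| < 1) ->
    forall i, (3 * y i < 3 * z i + k)%N.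
  move=> gy gz yz i; have : `|pt y - pt z| < 3^-1.
    apply: sP; [exact: box|exact: box|]; apply/rV_norm_lt => // j.
    by have := yz j; rewrite uB mulrC ltr_pdivrMr // mul1r.
  have e3 : 0 < 3^-1 :> R by rewrite invr_gt0.
  move/(proj1 (rV_norm_lt _ e3))/(_ i).
  rewrite !mxE -mulrBl normrM [ `|_^-1|]gtr0_norm ?invr_gt0 // ltr_pdivrMr //.
  rewrite ltr_norml => /andP[_]; rewrite -(ltr_nat R) !(natrD, natrM); lra.
have [c cP] := choice (fun y : {ffun 'I_m -> nat} => cover (u y)).
(* [K i] collects the points of colour i whose piece comes close to the face y i = 0. [F i], the
   face together with the grid neighbours of [K i], does not reach the opposite face. *)
pose K (i : 'I_m) (y : {ffun 'I_m -> nat}) := grid y /\ exists2 j : 'I_n.+1, j = i :> nat &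
  c y = j /\ exists z, [/\ grid z, c z = j, piece j (u y) = piece j (u z) & (z i <= 2)%N].
pose F (i : 'I_m) (y : {ffun 'I_m -> nat}) := y i = 0%N \/
  exists2 z, K i z & forall j, (y j <= z j + 1)%N /\ (z j <= y j + 1)%N.
have [||x [xk xF]] := @poincare_miranda_cube k m (fun i y => `[< ~ F i y >]) isT.
- by move=> i y _ y0; apply/negP => /asboolP; apply; left.
- move=> i y gy yk; apply/asboolP => -[|[z [gz [j ji [cz [w [gw cw pw wi]]]]] yz]].
    by rewrite yk.
  have := u_far _ _ gz gw (small _ _ _ pw) i; have := yz i; rewrite yk; lia.
have gx : grid x by move=> i; exact: ltnW.
(* As n < m, the colour of the corner x is itself a coordinate i. The cube has a point y in [F i],
   which puts x in [K i]; then its neighbour z is in [F i] too, a contradiction. *)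
pose i := widen_ord nm (c x).
have [y [z [xy xz /asboolPn/contrapT Fy /asboolP Fz]]] := xF i.
apply: Fz; right; exists x; last by move=> j; have := xz j; lia.
split=> //; exists (c x) => //; split=> //.
case: Fy => [y0|[w [gw [j ji [cw [v [gv cv pv vi]]]]] yw]].
  exists x; split=> //; have := xy i; lia.
have jc : j = c x by apply: val_inj; rewrite /= ji.
move: cw cv pv; rewrite jc => cw cv pv; exists v; split=> //; rewrite -pv; apply: sep.
- exact: cP.
- by rewrite -cw; exact: cP.
- by apply: u_close => // l; have := xy l; have := yw l; lia.
Qed.

End Dimension.

(** * Neumann series and bounded resolvents *)

Section RealNorm.
Variable R : realType.
Implicit Types A B : banachAlgType R.

(* Norms take values in R[i]; nr and modc below are their real versions. *)
Definition nr (V : normedModType R[i]) (x : V) : R := complex.Re `|x|.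

Lemma nrE (V : normedModType R[i]) (x : V) : `|x| = (nr x)%:C.
Proof. by rewrite /nr RRe_real // ger0_real. Qed.

Lemma nr_ge0 (V : normedModType R[i]) (x : V) : 0 <= nr x.
Proof. by rewrite -lecR -nrE; exact: normr_ge0. Qed.

Lemma nr0 (V : normedModType R[i]) : nr (0 : V) = 0.
Proof. by rewrite /nr normr0. Qed.

Lemma nr_eq0 (V : normedModType R[i]) (x : V) : nr x = 0 -> x = 0.
Proof. by move=> x0; apply/eqP; rewrite -normr_eq0 nrE x0. Qed.

Lemma nrD (V : normedModType R[i]) (x y : V) : nr (x + y) <= nr x + nr y.
Proof. by rewrite -lecR rmorphD /= -!nrE ler_normD. Qed.

Lemma nrN (V : normedModType R[i]) (x : V) : nr (- x) = nr x.
Proof. by rewrite /nr normrN. Qed.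

Lemma nrB (V : normedModType R[i]) (x y : V) : nr (x - y) <= nr x + nr y.
Proof. by rewrite -(nrN y) nrD. Qed.

Lemma nr_dist (V : normedModType R[i]) (x y z : V) : nr (x - z) <= nr (x - y) + nr (y - z).
Proof. by rewrite (le_trans _ (nrD _ _)) // addrA subrK. Qed.

Definition modc (a : R[i]) : R := complex.Re `|a|.

Lemma modcE (a : R[i]) : `|a| = (modc a)%:C.
Proof. by rewrite /modc RRe_real // ger0_real. Qed.

Lemma nrZ (V : normedModType R[i]) (a : R[i]) (x : V) :
  nr (a *: x) = modc a * nr x.
Proof. by apply: (@complexI R); rewrite -nrE normrZ rmorphM /= -nrE -modcE. Qed.

Lemma nr_bmul A (x y : A) : nr (bmul x y) <= nr x * nr y.
Proof. by rewrite -lecR rmorphM /= -!nrE normr_bmul. Qed.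

Lemma nr_ball (V : normedModType R[i]) (x y : V) (e : R) :
  ball x e%:C y <-> nr (x - y) < e.
Proof. by rewrite -ball_normE /= nrE ltcR. Qed.

Lemma geometric_small (c q e : R) : 0 <= q < 1 -> 0 < e -> exists N, c * q ^+ N < e.
Proof.
move=> /andP[q0 q1] e0; have : geometric c q @ \oo --> 0.
  by apply: cvg_geometric; rewrite ger0_norm.
move/cvgrPdist_lt/(_ e e0) => [N _ /(_ N (leqnn N))].
by rewrite /= sub0r normrN => H; exists N; exact: le_lt_trans (ler_norm _) H.
Qed.

Lemma seq_limit (V : completeNormedModType R[i]) (u : nat -> V) (c q : R) :
  0 <= q < 1 -> (forall n, nr (u n.+1 - u n) <= c * q ^+ n) ->
  exists z, forall e : R, 0 < e -> exists N, forall n, (N <= n)%N -> nr (z - u n) < e.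
Proof.
move=> /andP[q0 q1] uc.
have q1' : 0 < 1 - q by rewrite subr_gt0.
have uN n m : nr (u (n + m)%N - u n) * (1 - q) <= c * q ^+ n * (1 - q ^+ m).
  elim: m => [|m IH]; first by rewrite addn0 subrr nr0 mul0r expr0 subrr mulr0.
  rewrite addnS; have H1 := nr_dist (u (n + m).+1) (u (n + m)%N) (u n).
  have := uc (n + m)%N; rewrite exprD => H2; rewrite exprS; nra.
have c0 : 0 <= c by have := uc 0%N; rewrite expr0 mulr1; apply: le_trans; exact: nr_ge0.
have uN' n m : (n <= m)%N -> nr (u m - u n) <= c / (1 - q) * q ^+ n.
  move=> nm; rewrite mulrAC ler_pdivlMr //; have := uN n (m - n)%N; rewrite subnKC //.
  move/le_trans; apply; rewrite ler_piMr ?mulr_ge0 ?exprn_ge0 // gerBl.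
  exact: exprn_ge0.
have : cvg (u @ \oo).
  apply: cauchy_cvg; apply: cauchy_exP => e e0.
  have eE : e = (complex.Re e)%:C by rewrite RRe_real // gtr0_real.
  have e0' : 0 < complex.Re e by rewrite -ltcR -eE.
  have [|N HN] := @geometric_small (c / (1 - q)) q (complex.Re e) _ e0'; first by rewrite q0.
  exists (u N); exists N => // n /= Nn; rewrite eE; apply/nr_ball.
  by rewrite -nrN opprB (le_lt_trans (uN' _ _ Nn)).
move=> uz; exists (lim (u @ \oo)) => e e0.
move/cvgrPdist_lt : uz => /(_ e%:C); rewrite ltcR => /(_ e0)[N _ HN].
by exists N => n /HN /=; rewrite nrE ltcR.
Qed.

(** The iterates of x |-> y + L x from 0 are the partial sums of the Neumann series of (1 - L)^-1
    y. *)
Lemma affine_fixed_point (V : completeNormedModType R[i]) (L : V -> V) (q : R) (y : V) :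
  0 <= q < 1 -> {morph L : x y / x - y} -> (forall x, nr (L x) <= q * nr x) ->
  exists z, z = y + L z.
Proof.
move=> q01 LB Lq; have /andP[q0 q1] := q01.
pose u := fix u n := if n is n'.+1 then y + L (u n') else 0.
have uS n : u n.+1 = y + L (u n) by [].
have [|z zP] := @seq_limit V u (nr (u 1%N - u 0%N)) q q01.
  elim=> [|n IH]; first by rewrite expr0 mulr1.
  rewrite uS uS opprD addrACA subrr add0r -LB (le_trans (Lq _)) //.
  by rewrite exprS mulrCA ler_wpM2l.
exists z; apply/eqP; rewrite -subr_eq0; apply/eqP/nr_eq0/eqP.
rewrite eq_le nr_ge0 andbT leNgt; apply/negP => d0.
have [N NP] := zP _ (divr_gt0 d0 (ltr0n R 2)).
have h1 := NP N.+1 (leqnSn N); have h2 := NP N (leqnn N).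
have := nr_dist z (u N.+1) (y + L z).
have -> : u N.+1 - (y + L z) = L (u N - z) by rewrite uS opprD addrACA subrr add0r LB.
move=> h3.
have h4 := Lq (u N - z); rewrite -(nrN (u N - z)) opprB in h4.
have h5 := nr_ge0 (z - u N); have h6 : q * nr (z - u N) <= nr (z - u N) by rewrite ler_piMl // ltW.
lra.
Qed.

End RealNorm.

Section Modc.
Variable R : realType.
Implicit Types a b : R[i].

Lemma modc_ge0 a : 0 <= modc a.
Proof. by rewrite -lecR -modcE; exact: normr_ge0. Qed.

Lemma modcM a b : modc (a * b) = modc a * modc b.
Proof. by apply: (@complexI R); rewrite -modcE normrM rmorphM /= -!modcE. Qed.

Lemma modcD a b : modc (a + b) <= modc a + modc b.
Proof. by rewrite -lecR rmorphD /= -!modcE ler_normD. Qed.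

Lemma modcN a : modc (- a) = modc a.
Proof. by rewrite /modc normrN. Qed.

Lemma modcX a n : modc (a ^+ n) = modc a ^+ n.
Proof. by apply: (@complexI R); rewrite -modcE normrX rmorphXn /= -modcE. Qed.

Lemma modc_real (x : R) : modc x%:C = `|x|.
Proof. by rewrite /modc normc_def /= expr0n /= addr0 sqrtr_sqr. Qed.

Lemma modc0 : modc 0 = 0 :> R.
Proof. by rewrite /modc normr0. Qed.

Lemma modcV a : modc a^-1 = (modc a)^-1.
Proof. by apply: (@complexI R); rewrite fmorphV /= -!modcE normfV. Qed.

Lemma modc_nat n : modc n%:R = n%:R :> R.
Proof. by rewrite -(rmorph_nat (real_complex R)) modc_real normr_nat. Qed.

Lemma modc1 : modc 1 = 1 :> R.
Proof. by rewrite /modc normr1. Qed.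

Lemma modc_i : modc 'i%C = 1 :> R.
Proof. by rewrite /modc normc_def /= expr0n expr1n add0r sqrtr1. Qed.

Lemma modc_sqr a : modc a ^+ 2 = (complex.Re a) ^+ 2 + (complex.Im a) ^+ 2.
Proof. by apply: (@complexI R); rewrite rmorphXn /= -modcE -add_Re2_Im2. Qed.

Lemma modc_le_ReIm a : modc a <= `|complex.Re a| + `|complex.Im a|.
Proof.
rewrite {1}(complexE a) (le_trans (modcD _ _)) // modcM modc_i mul1r !modc_real //.
Qed.

Lemma Re_le_modc a : `|complex.Re a| <= modc a.
Proof. by rewrite -lecR -modcE normc_ge_Re. Qed.

Lemma Im_le_modc a : `|complex.Im a| <= modc a.
Proof. by have := Re_le_modc (a * 'i%C); rewrite ReiNIm normrN modcM modc_i mulr1. Qed.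

Lemma exists_root_of_N1 j : exists z : R[i], modc z = 1 /\ z ^+ (2 ^ j) = -1.
Proof.
elim: j => [|j [z [z1 zj]]]; first by exists (-1); rewrite modcN modc1 expr1.
exists (sqrtC z); rewrite expnS exprM sqrtCK; split=> //.
have : modc (sqrtC z) ^+ 2 = 1 by rewrite -modcX sqrtCK.
by move/eqP; rewrite sqrp_eq1 ?modc_ge0 // => /eqP.
Qed.

End Modc.

(** * Quasi-inverses and the resolvent identity in a non-unital algebra *)

Section QuasiInverse.
Variable R : realType.

Section Banach.
Variable A : banachAlgType R.
Implicit Types s x y q : A.

Lemma bmul0l x : bmul 0 x = 0.
Proof. by have := bmulZl 0 (0 : A) x; rewrite !scale0r. Qed.

Lemma bmul0r x : bmul x 0 = 0.
Proof. by have := bmulZr 0 x (0 : A); rewrite !scale0r. Qed.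

Lemma bmulNl x y : bmul (- x) y = - bmul x y.
Proof. by have := bmulZl (-1) x y; rewrite !scaleN1r. Qed.

Lemma bmulNr x y : bmul x (- y) = - bmul x y.
Proof. by have := bmulZr (-1) x y; rewrite !scaleN1r. Qed.

(* [quasi_inverse s q] says that 1 + q inverts 1 - s in the unitization. *)
Definition quasi_inverse s q := q = s + bmul s q /\ q = s + bmul q s.

Lemma quasi_inverse_exists s : nr s < 1 -> exists q, quasi_inverse s q.
Proof.
move=> s1; have s01 : 0 <= nr s < 1 by rewrite nr_ge0.
have [q qE] : exists q, q = s + bmul s q.
  apply: (affine_fixed_point s s01) => [x y|x]; last exact: nr_bmul.
  by rewrite bmulDr bmulNr.
exists q; split=> //; rewrite {1}qE; congr (_ + _); apply/eqP; rewrite -subr_eq0.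
(* The fixed point gives one of the two equations. The other follows because the commutator
   satisfies d = s d with [nr s < 1], so it vanishes. *)
pose d := bmul s q - bmul q s.
have dE : d = bmul s d.
  have sq : bmul s q = bmul s s + bmul s (bmul s q) by rewrite {1}qE bmulDr.
  have qs : bmul q s = bmul s s + bmul s (bmul q s) by rewrite {1}qE bmulDl bmulA.
  by rewrite /d bmulDr bmulNr {1}sq {1}qs opprD addrACA subrr add0r.
apply/eqP/nr_eq0/eqP; rewrite eq_le nr_ge0 andbT -/d.
have := nr_bmul s d; rewrite -dE; have := nr_ge0 d; nra.
Qed.

Lemma quasi_inverse_le s q : quasi_inverse s q -> nr q <= nr s + nr s * nr q.
Proof.
case=> qE _; rewrite {1}qE (le_trans (nrD _ _)) // lerD2l; exact: nr_bmul.
Qed.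

Lemma quasi_inverse_ge s q : quasi_inverse s q -> nr s <= nr q + nr s * nr q.
Proof.
case=> qE _; have {1}-> : s = q - bmul s q by rewrite {1}qE addrK.
by rewrite (le_trans (nrB _ _)) // lerD2l nr_bmul.
Qed.

(** In the unitization this is (1 - s^2)^-1 = ((1 - s)^-1 + (1 + s)^-1) / 2. *)
Lemma quasi_inverse_double s q q' : quasi_inverse s q -> quasi_inverse (- s) q' ->
  quasi_inverse (bmul s s) (2^-1 *: (q + q')).
Proof.
case=> q1 q2 [q1' q2'].
have E : q + q' = bmul s (q - q').
  by rewrite {1}q1 {1}q1' bmulNl addrACA subrr add0r bmulDr bmulNr.
have E' : q + q' = bmul (q - q') s.
  by rewrite {1}q2 {1}q2' bmulNr addrACA subrr add0r bmulDl bmulNl.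
have D : q - q' = s + s + bmul s (q + q').
  by rewrite {1}q1 {1}q1' bmulNl opprD !opprK addrACA bmulDr.
have D' : q - q' = s + s + bmul (q + q') s.
  by rewrite {1}q2 {1}q2' bmulNr opprD !opprK addrACA bmulDl.
have half (x : A) : 2^-1 *: (x + x) = x.
  by rewrite -mulr2n -[x *+ 2]scaler_nat scalerA mulVf ?scale1r // pnatr_eq0.
split; first by rewrite {1}E D bmulDr scalerDr bmulDr half bmulZr bmulA.
by rewrite {1}E' D' bmulDl scalerDr bmulDl half bmulZl -bmulA.
Qed.

(** The bracket is (1 + q) y (1 + q') expanded, with 1 + q and 1 + q' the inverses of 1 - m y and 1
    - m' y. *)
Lemma resolvent_identity y (m m' : R[i]) q q' :
  quasi_inverse (m *: y) q -> quasi_inverse (m' *: y) q' ->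
  q' - q = (m' - m) *: (y + bmul q y + (bmul y q' + bmul (bmul q y) q')).
Proof.
case=> [_ qE] [qE' _].
have E : bmul q q' = m *: (bmul y q' + bmul (bmul q y) q').
  by rewrite {1}qE bmulDl bmulZr !bmulZl -scalerDr.
have E' : bmul q q' = m' *: (bmul q y + bmul (bmul q y) q').
  by rewrite {1}qE' bmulDr bmulZl !bmulZr bmulA -scalerDr.
have X' : q' + bmul q q' = m' *: (y + bmul q y + (bmul y q' + bmul (bmul q y) q')).
  by rewrite E' {1}qE' bmulZl -!scalerDr addrACA.
have X : q + bmul q q' = m *: (y + bmul q y + (bmul y q' + bmul (bmul q y) q')).
  by rewrite E {1}qE bmulZr -!scalerDr.
by rewrite scalerBl -X -X' opprD addrACA subrr addr0.
Qed.

End Banach.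
End QuasiInverse.

Section ResolventBound.
Variables (R : realType) (B : banachAlgType R) (y : B) (q : R[i] -> B).
Hypothesis qP : forall m, modc m <= 2 -> quasi_inverse (m *: y) (q m).

Lemma resolvent_dist m m' : modc m <= 2 -> modc m' <= 2 ->
  nr (q m' - q m) <= modc (m' - m) * nr y * (1 + nr (q m)) * (1 + nr (q m')).
Proof.
move=> m2 m2'; rewrite (resolvent_identity (qP m2) (qP m2')) nrZ -!mulrA.
rewrite ler_wpM2l ?modc_ge0 //.
have h1 := nrD (y + bmul (q m) y) (bmul y (q m') + bmul (bmul (q m) y) (q m')).
have h2 := nrD y (bmul (q m) y).
have h3 := nrD (bmul y (q m')) (bmul (bmul (q m) y) (q m')).
have h4 := nr_bmul (q m) y; have h5 := nr_bmul y (q m').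
have h6 := nr_bmul (bmul (q m) y) (q m'); have h7 := nr_ge0 (q m').
have h8 : nr (bmul (q m) y) * nr (q m') <= nr (q m) * nr y * nr (q m').
  by rewrite ler_wpM2r.
rewrite (le_trans h1) // (le_trans (lerD h2 h3)) //.
have -> : nr y * ((1 + nr (q m)) * (1 + nr (q m'))) =
   nr y + nr (q m) * nr y + (nr y * nr (q m') + nr (q m) * nr y * nr (q m')) by ring.
lra.
Qed.

Lemma resolvent_bounded : exists2 C : R, 0 <= C &
  forall m, modc m <= 1 -> nr (q m) <= C.
Proof.
(* A square around the unit disc, compact as a product of segments; its points have modulus at most
   2, which is why [qP] reaches that far. *)
pose K : set (R * R) := `[(-1), 1] `*` `[(-1), 1].
have K2 (p : R * R) : K p -> modc (p.1 +i* p.2) <= 2.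
  case=> /=; rewrite !in_itv /= -!ler_norml => p1 p2.
  by rewrite (le_trans (modc_le_ReIm _)) // -[2]/(1 + 1) lerD.
have cK : compact K by apply: compact_setX; exact: segment_compact.
have /compact_near_coveringP cov := cK.
have [p Kp|C [_ CP]] := cov R (pinfty_nbhs R)
    (fun M p => K p -> nr (q (p.1 +i* p.2)) <= M) _; last first.
  exists (Num.max C 0 + 1) => [|m m1].
    by rewrite addr_ge0 // le_max lexx orbT.
  have Km : K (complex.Re m, complex.Im m).
    by split; rewrite /= in_itv /= -ler_norml (le_trans _ m1) ?Re_le_modc ?Im_le_modc.
  have := CP (Num.max C 0 + 1) _ _ Km Km; case: (m) => a b /=; apply.
  by rewrite (@le_lt_trans _ _ (Num.max C 0)) ?ltrDl // le_max lexx.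
pose M0 := nr (q (p.1 +i* p.2)); have M00 : 0 <= M0 by exact: nr_ge0.
(* Near p one has d < 2 e, hence d * nr y * (1 + M0) <= 1/2, and [resolvent_dist] becomes Q <= M0 +
   (1 + Q) / 2, that is Q <= 2 M0 + 1. *)
pose e : R := (4 * (1 + nr y) * (1 + M0))^-1.
have y0 := nr_ge0 y.
have D0 : 0 < 4 * (1 + nr y) * (1 + M0) by rewrite !mulr_gt0 // ltr_wpDr.
have e0 : 0 < e by rewrite invr_gt0.
exists (ball p e, [set M | 2 * M0 + 1 < M]); first split.
- exact: nbhsx_ballx.
- by exists (2 * M0 + 1); split => //; exact: num_real.
case=> x M /= [[px1 px2] M0M] Kx; apply: le_trans (ltW M0M).
have := resolvent_dist (K2 _ Kp) (K2 _ Kx); rewrite -/M0.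
set Q := nr (q (x.1 +i* x.2)); have Q0 : 0 <= Q by exact: nr_ge0.
have h1 : Q <= nr (q (x.1 +i* x.2) - q (p.1 +i* p.2)) + M0.
  by rewrite /Q /M0; have := nrD (q (x.1 +i* x.2) - q (p.1 +i* p.2)) (q (p.1 +i* p.2)); rewrite subrK.
set d := modc _; have d0 : 0 <= d by exact: modc_ge0.
have de : d < 2 * e.
  rewrite (le_lt_trans (modc_le_ReIm _)) // mulr_natl mulr2n /= ltrD // distrC.
    exact: px1.
  exact: px2.
have eE : 4 * (1 + nr y) * (1 + M0) * e = 1 by rewrite mulfV // gt_eqF.
have h2 : d * nr y * (1 + M0) <= 2^-1 by nra.
move=> h3; have h4 : d * nr y * (1 + M0) * (1 + Q) <= 2^-1 * (1 + Q).
  by rewrite ler_wpM2r // addr_ge0.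
lra.
Qed.
Definition bsqr (x : B) := bmul x x.

(* h m is the average of the resolvents at the points z m, z ranging over the
   2^j-th roots of unity; averaging preserves the Lipschitz constant along
   rays, which is therefore independent of j. *)
Lemma averaged_resolvent : exists2 D : R, 0 <= D & forall j, exists h : R[i] -> B,
  (forall m, modc m <= 1 -> quasi_inverse (m ^+ (2 ^ j) *: iter j bsqr y) (h m)) /\
  (forall m (t t' : R), modc m = 1 -> 0 <= t <= 1 -> 0 <= t' <= 1 ->
    nr (h (t'%:C * m) - h (t%:C * m)) <= D * `|t' - t|).
Proof.
have [C C0 CP] := resolvent_bounded.
have modt (t : R) m : modc m = 1 -> 0 <= t <= 1 -> modc (t%:C * m) <= 1.
  by move=> m1 /andP[t0 t1]; rewrite modcM m1 mulr1 modc_real ger0_norm.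
exists (nr y * (1 + C) * (1 + C)).
  by rewrite !mulr_ge0 ?nr_ge0 // addr_ge0.
elim=> [|j [h [hQ hL]]].
  exists q; split=> [m m1|m t t' m1 t01 t01'].
    by rewrite expr1; apply: qP; rewrite (le_trans m1) // ler1n.
  have h1 := modt _ _ m1 t01; have h2 := modt _ _ m1 t01'.
  rewrite (le_trans (resolvent_dist _ _)) ?(le_trans h1) ?(le_trans h2) ?ler1n //.
  rewrite -mulrBl -rmorphB modcM m1 mulr1 modc_real.
  rewrite [leRHS]mulrC !mulrA ler_pM ?mulr_ge0 ?addr_ge0 ?nr_ge0 //; last by rewrite lerD2l CP.
  by rewrite ler_wpM2l ?mulr_ge0 ?nr_ge0 // lerD2l CP.
(* Multiplying m by z changes the sign of m ^ (2 ^ j), as [quasi_inverse_double] requires. *)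
have [z [z1 zj]] := exists_root_of_N1 R j.
exists (fun m => 2^-1 *: (h m + h (z * m))); split=> [m m1|m t t' m1 t01 t01'].
  have := quasi_inverse_double (hQ _ m1) (q' := h (z * m)).
  rewrite /bsqr bmulZl bmulZr scalerA -expr2 -exprM mulnC -expnS; apply.
  by rewrite -scaleN1r -zj scalerA -exprMn; apply: hQ; rewrite modcM z1 mul1r.
rewrite -scalerBr nrZ opprD addrACA !(mulrCA z).
have zm : modc (z * m) = 1 by rewrite modcM z1 m1 mulr1.
have := nrD (h (t'%:C * m) - h (t%:C * m)) (h (t'%:C * (z * m)) - h (t%:C * (z * m))).
have := hL m t t' m1 t01 t01'; have := hL (z * m) t t' zm t01 t01'.
have -> : modc (2^-1 : R[i]) = 2^-1.
  by rewrite modcV modc_nat.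
lra.
Qed.

(* If nr y > 1, the Lipschitz bound compares the averages at radii just below and
   just above 1 / nr y: for large j the first is close to 0, hence the second is
   at most 1/2 and y^(2^j) scaled by the larger radius has norm at most 1, which
   contradicts nr (y^(2^j)) = (nr y)^(2^j). *)
Lemma quasi_inverse_radius : (forall j, nr (iter j bsqr y) = nr y ^+ (2 ^ j)) -> nr y <= 1.
Proof.
move=> yj; rewrite leNgt; apply/negP => y1.
have [D D0 DP] := averaged_resolvent.
set K := nr y in y1 yj *; have K0 : 0 < K by exact: lt_trans y1.
(* The last two bounds keep both radii in [0, 1]. The first gives D d <= 1/4; a power below 1/5 at
   the inner radius bounds that average by 1/4, so the outer one is at most 1/2. *)
pose d := Num.min (4 * (D + 1))^-1 (Num.min K^-1 (1 - K^-1)).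
have Ki : K^-1 < 1 by rewrite invf_lt1.
have d0 : 0 < d by rewrite !lt_min !invr_gt0 K0 subr_gt0 Ki mulr_gt0 // ltr_wpDl.
have d1 : d <= (4 * (D + 1))^-1 by rewrite ge_min lexx.
have d2 : d <= K^-1 by rewrite !ge_min lexx orbT.
have d3 : d <= 1 - K^-1 by rewrite !ge_min lexx !orbT.
have KK : K * K^-1 = 1 by rewrite mulfV // gt_eqF.
have Dd : D * d <= 4^-1.
  have D1 : 0 < 4 * (D + 1) by rewrite mulr_gt0 // ltr_wpDl.
  have : (4 * (D + 1)) * d <= 1 by rewrite mulrC -ler_pdivlMr // mul1r.
  lra.
pose t := K^-1 - d / 2; pose t' := K^-1 + d / 2.
have t01 : 0 <= t <= 1 by rewrite /t; lra.
have t01' : 0 <= t' <= 1 by rewrite /t'; lra.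
have tK0 : 0 <= t * K < 1 by apply/andP; split; rewrite /t; nra.
have tK' : 1 < t' * K by rewrite /t'; nra.
have [j jP] : exists j, 1 * (t * K) ^+ j < 5^-1 by apply: geometric_small.
have {}jP : (t * K) ^+ (2 ^ j) < 5^-1.
  apply: le_lt_trans jP; rewrite mul1r ler_wiXn2l ?(ltnW (ltn_expl _ _)) //.
  - by case/andP: tK0.
  - by case/andP: tK0 => _ /ltW.
have [h [hQ hL]] := DP j.
have nrs (x : R) : 0 <= x -> nr ((x%:C * 1) ^+ (2 ^ j) *: iter j bsqr y) = (x * K) ^+ (2 ^ j).
  by move=> x0; rewrite nrZ mulr1 yj modcX modc_real ger0_norm // exprMn.
have m1 (x : R) : 0 <= x <= 1 -> modc (x%:C * 1) <= 1.
  by move=> /andP[x0 x1]; rewrite mulr1 modc_real ger0_norm.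
have := quasi_inverse_le (hQ _ (m1 _ t01)).
have := quasi_inverse_ge (hQ _ (m1 _ t01')).
have := hL 1 t t' (modc1 R) t01 t01'.
have t0 : 0 <= t by case/andP: t01.
have t0' : 0 <= t' by case/andP: t01'.
rewrite !nrs //.
have -> : t' - t = d by rewrite /t /t'; lra.
rewrite (ger0_norm (ltW d0)).
have := nrD (h (t'%:C * 1) - h (t%:C * 1)) (h (t%:C * 1)); rewrite subrK.
have : 1 < (t' * K) ^+ (2 ^ j) by rewrite exprn_egt1 // -lt0n expn_gt0.
have := nr_ge0 (h (t%:C * 1)); have := nr_ge0 (h (t'%:C * 1)).
have : 0 <= (t * K) ^+ (2 ^ j) by rewrite exprn_ge0 //; case/andP: tK0.
set a := nr (h (t%:C * 1)); set a' := nr (h (t'%:C * 1)); set b := nr (_ - _).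
set r := (t * K) ^+ _ in jP *; set r' := (t' * K) ^+ _.
move=> r0 a'0 a0 r'1 a'b bD r'a ra.
have h1 : a <= 4^-1 by nra.
have h2 : a' <= 2^-1 by lra.
nra.
Qed.

End ResolventBound.

(** * Boundedness of *-morphisms *)

Section StarMorphism.
Variables (R : realType).

Lemma nr_star_sqr (A : cstarAlgType R) (x : A) : nr (bmul (star x) x) = nr x ^+ 2.
Proof. by apply: (@complexI R); rewrite -nrE normr_star_bmul rmorphXn /= -nrE. Qed.

Lemma nr_star (A : cstarAlgType R) (x : A) : nr (star x) = nr x.
Proof.
have le (z : A) : nr z <= nr (star z).
  have := nr_bmul (star z) z; rewrite nr_star_sqr.
  by have [->|z0] := eqVneq (nr z) 0; rewrite ?nr_ge0 // expr2 ler_pM2r // lt_def z0 nr_ge0.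
by apply/eqP; rewrite eq_le le -{2}(starK x) le.
Qed.

Lemma nr_selfadjoint_iter (A : cstarAlgType R) (x : A) j : star x = x ->
  nr (iter j (@bsqr R A) x) = nr x ^+ (2 ^ j).
Proof.
move=> xs; have sa : star (iter j (@bsqr R A) x) = iter j (@bsqr R A) x.
  by elim: j => //= j IH; rewrite /bsqr starM IH.
elim: j sa => [|j IH] sa; first by rewrite expr1.
have sj : star (iter j (@bsqr R A) x) = iter j (@bsqr R A) x.
  by elim: (j) => //= i IHi; rewrite /bsqr starM IHi.
by rewrite iterS /bsqr -{1}sj nr_star_sqr IH // -exprM mulnC -expnS.
Qed.

(** If x is self-adjoint with norm below 1/2, every m x with |m| <= 2 has a quasi-inverse, which f
    carries over; [quasi_inverse_radius] then bounds f x by 1. Rescaling to norm 1/3 gives the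
    constant 3 on self-adjoint elements, and the C*-identity turns it into sqrt 3 <= 2 on all
    elements. *)
Lemma star_morphism_bounded (A B : cstarAlgType R) (f : {linear A -> B}) :
  star_morphism f -> forall x, nr (f x) <= 2 * nr x.
Proof.
case=> fM fS.
have small (x : A) : star x = x -> nr x < 2^-1 -> nr (f x) <= 1.
  move=> xs x2; have ex (m : R[i]) : exists q, modc m <= 2 -> quasi_inverse (m *: f x) q.
    have [m2|m2] := boolP (modc m <= 2); last by exists 0.
    have [|q [q1 q2]] := @quasi_inverse_exists R A (m *: x).
      by rewrite nrZ; have := modc_ge0 m; have := nr_ge0 x; nra.
    exists (f q) => _; split.
      by rewrite {1}q1 linearD fM linearZ.
    by rewrite {1}q2 linearD fM linearZ.
  have [q qP] := choice ex; apply: (quasi_inverse_radius qP) => j.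
  by apply: nr_selfadjoint_iter; rewrite -fS xs.
have sa (x : A) : star x = x -> nr (f x) <= 3 * nr x.
  move=> xs; have [x0|x0] := eqVneq (nr x) 0.
    by rewrite (nr_eq0 x0) linear0 !nr0 mulr0.
  have xp : 0 < 3 * nr x by rewrite mulr_gt0 // lt_def x0 nr_ge0.
  have mr : modc ((3 * nr x)^-1)%:C = (3 * nr x)^-1.
    by rewrite modc_real ger0_norm // invr_ge0 ltW.
  have := small (((3 * nr x)^-1)%:C *: x).
  rewrite starZ conj_Creal ?complex_real // xs linearZ !nrZ mr.
  rewrite ler_pdivrMl // mulr1; apply => //.
  rewrite invfM -mulrA mulVf // mulr1; lra.
move=> x; have := sa (bmul (star x) x).
rewrite starM starK fM fS !nr_star_sqr => /(_ erefl) H.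
rewrite -(ler_pXn2r (n := 2)) ?nnegrE ?mulr_ge0 ?nr_ge0 // exprMn (le_trans H) //.
by rewrite ler_wpM2r ?sqr_ge0 // -natrX ler_nat.
Qed.

End StarMorphism.

(** * Matrices with the operator norm *)

HB.lock Definition rvn (R : realType) n (u : 'rV[R[i]]_n) : R :=
  complex.Re (sqrtC (dotmx u u)).

HB.lock Definition opn (R : realType) n (a : 'M[R[i]]_n.+1) : R :=
  sup [set rvn (u *m a) | u in [set u : 'rV[R[i]]_n.+1 | rvn u <= 1]].

Section RowNorm.
Variables (R : realType) (n : nat).
Implicit Types u v : 'rV[R[i]]_n.

Lemma rvnE u : sqrtC (dotmx u u) = (rvn u)%:C.
Proof. by rewrite rvn.unlock RRe_real // ger0_real // sqrtC_ge0 dnorm_ge0. Qed.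

Lemma rvn_sqr u : dotmx u u = (rvn u ^+ 2)%:C.
Proof. by rewrite rmorphXn /= -rvnE sqrtCK. Qed.

Lemma rvn_ge0 u : 0 <= rvn u.
Proof. by rewrite -lecR -rvnE sqrtC_ge0 dnorm_ge0. Qed.

Lemma rvnD u v : rvn (u + v) <= rvn u + rvn v.
Proof. by rewrite -lecR rmorphD /= -!rvnE; have [] := triangle_lerif (@dotmx _ _) u v. Qed.

Lemma rvnZ (c : R[i]) u : rvn (c *: u) = modc c * rvn u.
Proof.
apply: (@complexI R); rewrite rmorphM /= -!rvnE -modcE dnormZ.
by rewrite sqrtCM ?nnegrE ?exprn_ge0 ?dnorm_ge0 // sqrCK.
Qed.

Lemma rvn0 : rvn (0 : 'rV[R[i]]_n) = 0.
Proof. by rewrite rvn.unlock linear0l sqrtC0. Qed.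

Lemma rvn_eq0 u : rvn u = 0 -> u = 0.
Proof.
move=> u0; apply/eqP; have := dnorm_eq0 (@dotmx _ n) u.
by rewrite -[X in X == 0]/(dotmx u u) rvn_sqr u0 expr0n eqxx => <-.
Qed.

Lemma dotmx_le u v : modc (dotmx u v) <= rvn u * rvn v.
Proof.
by rewrite -lecR rmorphM /= -modcE -!rvnE; have [] := CauchySchwarz_sqrt (@dotmx _ _) u v.
Qed.

Lemma rvn_delta j : rvn (delta_mx 0 j : 'rV[R[i]]_n) = 1.
Proof.
rewrite rvn.unlock dotmxE (_ : (_ *m _) 0 0 = 1) ?sqrtC1 //.
rewrite mxE (bigD1 j) //= big1 => [|i /negbTE ij]; rewrite !mxE !eqxx /=.
  by rewrite conjC1 mulr1 addr0.
by rewrite ij mul0r.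
Qed.

Lemma modc_le_rvn u j : modc (u 0 j) <= rvn u.
Proof.
have := dotmx_le u (delta_mx 0 j); rewrite rvn_delta mulr1.
rewrite dotmxE mxE (bigD1 j) //= big1 => [|i /negbTE ij]; rewrite !mxE !eqxx /=.
  by rewrite conjC1 mulr1 addr0.
by rewrite ij conjC0 mulr0.
Qed.

End RowNorm.

Lemma rvn_sum (R : realType) n (I : finType) (F : I -> 'rV[R[i]]_n) :
  rvn (\sum_i F i) <= \sum_i rvn (F i).
Proof.
elim/big_ind2 : _ => [|x y x' y' hx hy|//]; first by rewrite rvn0.
by rewrite (le_trans (rvnD _ _)) // lerD.
Qed.

Section OperatorNorm.
Variables (R : realType) (n : nat).
Implicit Types a b : 'M[R[i]]_n.+1.

Lemma rvn_mul_le a u : rvn (u *m a) <= rvn u * \sum_i \sum_j modc (a i j).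
Proof.
have -> : u *m a = \sum_i \sum_j (u 0 i * a i j) *: delta_mx 0 j.
  rewrite mulmx_sum_row; apply: eq_bigr => i _; rewrite {1}(row_sum_delta (row i a)).
  by rewrite scaler_sumr; apply: eq_bigr => j _; rewrite mxE scalerA.
rewrite (le_trans (rvn_sum _)) // mulr_sumr ler_sum // => i _.
rewrite (le_trans (rvn_sum _)) // mulr_sumr ler_sum // => j _.
rewrite rvnZ rvn_delta mulr1 modcM ler_wpM2r ?modc_ge0 //; exact: modc_le_rvn.
Qed.

Lemma opn_has_sup a :
  has_sup [set rvn (u *m a) | u in [set u : 'rV[R[i]]_n.+1 | rvn u <= 1]].
Proof.
split; first by exists (rvn (0 *m a)); exists 0 => //=; rewrite rvn0.
exists (\sum_i \sum_j modc (a i j)) => _ [u u1 <-].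
rewrite (le_trans (rvn_mul_le _ _)) // ler_piMl //.
by do 2! apply: sumr_ge0 => ? _; exact: modc_ge0.
Qed.

Lemma opn_ge0 a : 0 <= opn a.
Proof.
rewrite opn.unlock; apply: sup_upper_bound; first exact: opn_has_sup.
by exists 0; rewrite /= ?mul0mx rvn0.
Qed.

Lemma rvn_mul a u : rvn (u *m a) <= opn a * rvn u.
Proof.
have [u0|u0] := eqVneq (rvn u) 0; first by rewrite (rvn_eq0 u0) mul0mx !rvn0 mulr0.
have up : 0 < rvn u by rewrite lt_def u0 rvn_ge0.
rewrite -ler_pdivrMr // mulrC.
have mu : modc ((rvn u)^-1)%:C = (rvn u)^-1 by rewrite modc_real ger0_norm // invr_ge0 ltW.
rewrite -mu -rvnZ scalemxAl; rewrite opn.unlock; apply: sup_upper_bound; first exact: opn_has_sup.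
by exists (((rvn u)^-1)%:C *: u) => //=; rewrite rvnZ mu mulVf.
Qed.

Lemma opn_le a (M : R) : 0 <= M -> (forall u, rvn (u *m a) <= M * rvn u) -> opn a <= M.
Proof.
move=> M0 H; rewrite opn.unlock; apply: ge_sup; first by have [] := opn_has_sup a.
by move=> _ [u u1 <-]; rewrite (le_trans (H u)) // ler_piMr.
Qed.

Lemma opnD a b : opn (a + b) <= opn a + opn b.
Proof.
apply: opn_le => [|u]; first by rewrite addr_ge0 ?opn_ge0.
by rewrite mulmxDr mulrDl (le_trans (rvnD _ _)) // lerD ?rvn_mul.
Qed.

Lemma opnM a b : opn (a *m b) <= opn a * opn b.
Proof.
apply: opn_le => [|u]; first by rewrite mulr_ge0 ?opn_ge0.
rewrite mulmxA; apply: le_trans (rvn_mul b (u *m a)) _.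
have h := rvn_mul a u.
have h0 := opn_ge0 b.
have E : opn b * (opn a * rvn u) = opn a * opn b * rvn u by ring.
rewrite -E.
exact: ler_wpM2l.
Qed.

Lemma opnZ_le (c : R[i]) a : opn (c *: a) <= modc c * opn a.
Proof.
apply: opn_le => [|u]; first by rewrite mulr_ge0 ?opn_ge0 ?modc_ge0.
by rewrite -scalemxAr rvnZ -mulrA ler_wpM2l ?modc_ge0 ?rvn_mul.
Qed.

Lemma opnZ (c : R[i]) a : opn (c *: a) = modc c * opn a.
Proof.
apply/eqP; rewrite eq_le opnZ_le /=.
have [->|c0] := eqVneq c 0.
  by rewrite modc0 mul0r opn_ge0.
have := opnZ_le c^-1 (c *: a); rewrite scalerA mulVf // scale1r modcV.
have c1 : 0 < modc c by rewrite -ltcR -modcE normr_gt0.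
by rewrite ler_pdivlMl.
Qed.

Lemma entry_le_opn a i j : modc (a i j) <= opn a.
Proof.
have := rvn_mul a (delta_mx 0 i); rewrite rvn_delta mulr1; apply: le_trans.
by have := modc_le_rvn (delta_mx 0 i *m a) j; rewrite -rowE mxE.
Qed.

Lemma opn_le_entries a : opn a <= \sum_i \sum_j modc (a i j).
Proof.
apply: opn_le => [|u]; last by rewrite mulrC rvn_mul_le.
by do 2! apply: sumr_ge0 => ? _; exact: modc_ge0.
Qed.

Lemma opn_eq0 a : opn a = 0 -> a = 0.
Proof.
move=> a0; apply/matrixP => i j; rewrite mxE; apply/eqP; rewrite -normr_eq0 modcE.
have := entry_le_opn a i j; rewrite a0 => h.
by have /eqP -> : modc (a i j) == 0 by rewrite eq_le h modc_ge0.
Qed.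

Definition adjmx a := (a ^t Num.conj)%sesqui.

(** By Cauchy-Schwarz, |u a|^2 = <u a a^*, u> <= |a a^*| |u|^2. *)
Lemma opn_adj_sqr a : opn a ^+ 2 <= opn (a *m adjmx a).
Proof.
have A0 := opn_ge0 (a *m adjmx a).
rewrite -[leRHS]sqr_sqrtr // ler_sqr ?nnegrE ?sqrtr_ge0 ?opn_ge0 //.
apply: opn_le => [|u]; first exact: sqrtr_ge0.
rewrite -(ler_pXn2r (n := 2)) ?nnegrE ?mulr_ge0 ?sqrtr_ge0 ?rvn_ge0 //.
rewrite exprMn sqr_sqrtr //.
have -> : rvn (u *m a) ^+ 2 = modc (dotmx (u *m (a *m adjmx a)) u).
  have -> : dotmx (u *m (a *m adjmx a)) u = dotmx (u *m a) (u *m a).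
    by rewrite !dotmxE /adjmx trmx_mul map_mxM !mulmxA.
  by rewrite rvn_sqr modc_real ger0_norm // sqr_ge0.
apply: le_trans (dotmx_le _ _) _; rewrite expr2 mulrA ler_wpM2r ?rvn_ge0 //.
exact: rvn_mul.
Qed.

Lemma adjmxK a : adjmx (adjmx a) = a.
Proof. by apply/matrixP => i j; rewrite !mxE conjCK. Qed.

Lemma opn_adj a : opn (adjmx a) = opn a.
Proof.
have le b : opn b <= opn (adjmx b).
  have := le_trans (opn_adj_sqr b) (opnM _ _); rewrite expr2.
  have [->|b0] := eqVneq (opn b) 0; first by rewrite opn_ge0.
  by rewrite ler_pM2l // lt_def b0 opn_ge0.
by apply/eqP; rewrite eq_le le -{2}(adjmxK a) le.
Qed.

Lemma opn_cstar a : opn (adjmx a *m a) = opn a ^+ 2.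
Proof.
apply/eqP; rewrite eq_le; apply/andP; split.
  by rewrite (le_trans (opnM _ _)) // opn_adj expr2.
by have := opn_adj_sqr (adjmx a); rewrite opn_adj adjmxK.
Qed.

End OperatorNorm.

(* MathComp-Analysis puts the maximum norm on 'M[R[i]]; this alias carries the
   norm of the operators u |-> u *m a on row vectors. *)
Definition opmx (R : realType) (n : nat) : Type := 'M[R[i]]_n.+1.

Section MatrixCStar.
Variables (R : realType) (n : nat).

HB.instance Definition _ := GRing.Lmodule.copy (opmx R n) 'M[R[i]]_n.+1.

Definition opnorm (a : opmx R n) : R[i] := (opn a)%:C.

Lemma opnormD (a b : opmx R n) : opnorm (a + b) <= opnorm a + opnorm b.
Proof. by rewrite -rmorphD lecR; exact: opnD. Qed.

Lemma opnormZ (c : R[i]) (a : opmx R n) : opnorm (c *: a) = `|c| * opnorm a.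
Proof. by rewrite modcE -rmorphM; congr (_%:C); exact: opnZ. Qed.

Lemma opnorm_eq0 (a : opmx R n) : opnorm a = 0 -> a = 0.
Proof. by move=> /complexI/opn_eq0. Qed.

HB.instance Definition _ := @Lmodule_isNormed.Build R[i] (opmx R n)
  opnorm opnormD opnormZ opnorm_eq0.

Lemma nr_opmx (a : opmx R n) : nr a = opn a.
Proof. by []. Qed.

Lemma opmx_complete (F : set_system (opmx R n)) :
  ProperFilter F -> cauchy F -> cvg F.
Proof.
move=> FF /cauchyP Fc.
have cvgR (g : opmx R n -> R) : (forall a b, `|g a - g b| <= nr (a - b)) -> cvg (g @ F).
  move=> gl; apply: cauchy_cvg; apply: cauchy_exP => e e0.
  have eC : 0 < e%:C by rewrite ltcR.
  have [a aF] := Fc e%:C eC; exists (g a).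
  suff : ball a e%:C `<=` [set b | `|g a - g b| < e] by move=> H; exact: filterS H aF.
  by move=> b /nr_ball; exact: le_lt_trans.
have entryB i j (a b : opmx R n) : modc (a i j - b i j) <= nr (a - b).
  by have := entry_le_opn (a - b) i j; rewrite !mxE.
have cRe i j : cvg ((fun a : opmx R n => complex.Re (a i j)) @ F).
  apply: cvgR => a b; rewrite -raddfB; apply: le_trans (entryB i j a b); exact: Re_le_modc.
have cIm i j : cvg ((fun a : opmx R n => complex.Im (a i j)) @ F).
  apply: cvgR => a b; rewrite -raddfB; apply: le_trans (entryB i j a b); exact: Im_le_modc.
pose L : opmx R n := \matrix_(i, j) (lim ((fun a : opmx R n => complex.Re (a i j)) @ F) +i*
  lim ((fun a : opmx R n => complex.Im (a i j)) @ F)).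
apply/cvg_ex; exists L; apply/cvgrPdist_lt => e e0.
have eE : e = (complex.Re e)%:C by rewrite RRe_real // gtr0_real.
have e0' : 0 < complex.Re e by rewrite -ltcR -eE.
(* The outer successor makes the sum of (n + 1)^2 bounds 2 d strictly less than [complex.Re e]. *)
pose d := complex.Re e / (2 * (n.+1 * n.+1).+1%:R).
have d0 : 0 < d by rewrite divr_gt0 // mulr_gt0.
have near_entries : \forall a \near F, forall ij : 'I_n.+1 * 'I_n.+1,
    modc ((L - a) ij.1 ij.2) < 2 * d.
  apply: filter_forall => -[i j] /=.
  have /cvgrPdist_lt/(_ d d0) hR := cRe i j.
  have /cvgrPdist_lt/(_ d d0) hI := cIm i j.
  near=> a; rewrite !mxE (le_lt_trans (modc_le_ReIm _)) // !raddfB mulr_natl mulr2n ltrD //=.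
    by near: a; exact: hR.
  by near: a; exact: hI.
near=> a; rewrite eE [ltLHS]nrE ltcR nr_opmx.
have aP : forall ij : 'I_n.+1 * 'I_n.+1, modc ((L - a) ij.1 ij.2) < 2 * d by near: a.
apply: (@le_lt_trans _ _ (\sum_(i < n.+1) \sum_(j < n.+1) 2 * d)).
  apply: le_trans (opn_le_entries _) _.
  by apply: ler_sum => i _; apply: ler_sum => j _; exact: ltW (aP (i, j)).
have dE : complex.Re e = 2 * d * (n.+1 * n.+1).+1%:R.
  have n0 : 0 <= n%:R :> R by [].
  by rewrite /d; field; rewrite gt_eqF //; nra.
rewrite !sumr_const !card_ord -mulrnA -[ltLHS]mulr_natr dE ltr_pM2l ?ltr_nat //.
by rewrite mulr_gt0.
Unshelve. all: by end_near. Qed.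

HB.instance Definition _ := Uniform_isComplete.Build (opmx R n) opmx_complete.

Definition opmul (a b : opmx R n) : opmx R n := a *m b.
Definition opstar (a : opmx R n) : opmx R n := adjmx a.

Lemma opnorm_mul (a b : opmx R n) : `|opmul a b| <= `|a| * `|b|.
Proof. by rewrite !nrE -rmorphM lecR !nr_opmx; exact: opnM. Qed.

Lemma opmulZl (c : R[i]) (x y : opmx R n) : opmul (c *: x) y = c *: opmul x y.
Proof. exact/esym/scalemxAl. Qed.

Lemma opmulZr (c : R[i]) (x y : opmx R n) : opmul x (c *: y) = c *: opmul x y.
Proof. exact/esym/scalemxAr. Qed.

HB.instance Definition _ := @isBanachAlgebra.Build R (opmx R n)
  opmul (@mulmxA _ _ _ _ _) (fun x y z => mulmxDl x y z) (fun x y z => mulmxDr x y z)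
  opmulZl opmulZr opnorm_mul.

Lemma opstarD : {morph opstar : x y / x + y}.
Proof. by move=> x y; apply/matrixP => i j; rewrite !mxE rmorphD. Qed.

Lemma opstarZ (c : R[i]) (x : opmx R n) : opstar (c *: x) = Num.conj c *: opstar x.
Proof. by apply/matrixP => i j; rewrite !mxE rmorphM. Qed.

Lemma opstarM (x y : opmx R n) : opstar (bmul x y) = bmul (opstar y) (opstar x).
Proof. by rewrite /opstar /adjmx trmx_mul map_mxM. Qed.

Lemma opnorm_star_mul (x : opmx R n) : `|bmul (opstar x) x| = `|x| ^+ 2.
Proof. by rewrite !nrE -rmorphXn; congr (_%:C); exact: opn_cstar. Qed.

HB.instance Definition _ := @isCStarAlgebra.Build R (opmx R n)
  opstar (@adjmxK R n) opstarD opstarZ opstarM opnorm_star_mul.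

End MatrixCStar.

(** * From multigraph isomorphisms to algebra isomorphisms *)

(** Each e goes to the element at the same position in the enumeration of the corresponding fibre of
    p2. *)
Lemma fiber_injection (E1 E2 : finType) (T : eqType) (p1 : E1 -> T) (p2 : E2 -> T) :
  (forall e : E1, #|[set e' | p1 e' == p1 e]%SET| = #|[set e' | p2 e' == p1 e]%SET|) ->
  exists2 f : E1 -> E2, injective f & forall e, p2 (f e) = p1 e.
Proof.
move=> cards; pose F1 t := enum [set e | p1 e == t]%SET; pose F2 t := enum [set e | p2 e == t]%SET.
have /choice[f fP] : forall e : E1, exists e' : E2,
    p2 e' = p1 e /\ index e' (F2 (p1 e)) = index e (F1 (p1 e)).
  move=> e; have ie : (index e (F1 (p1 e)) < size (F2 (p1 e)))%N.
    by rewrite -cardE -cards cardE index_mem mem_enum inE.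
  have [e0 _] : exists e0 : E2, true by case: (F2 _) ie => // e0; exists e0.
  exists (nth e0 (F2 (p1 e)) (index e (F1 (p1 e)))); split.
    by apply/eqP; have := mem_nth e0 ie; rewrite mem_enum inE.
  by rewrite index_uniq // enum_uniq.
exists f => [e e' ff|e]; last by case: (fP e).
have [pe ie] := fP e; have [pe' ie'] := fP e'.
have pp : p1 e = p1 e' by rewrite -pe -pe' ff.
move: ie; rewrite ff pp ie' => /eqP; rewrite eq_sym => /eqP/(@index_inj _ e).
by apply; rewrite mem_enum inE ?pp.
Qed.

Lemma fiber_bijection (E1 E2 : finType) (T : eqType) (p1 : E1 -> T) (p2 : E2 -> T) :
  (forall t, #|[set e | p1 e == t]%SET| = #|[set e | p2 e == t]%SET|) ->
  exists2 f : E1 -> E2, bijective f & forall e, p2 (f e) = p1 e.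
Proof.
move=> cards; have [f fi fp] := fiber_injection (fun e => cards (p1 e)).
have [g gi _] := fiber_injection (fun e => esym (cards (p2 e))).
by exists f => //; apply: inj_card_bij fi (leq_card g gi).
Qed.

Lemma imset_set2 (T U : finType) (f : T -> U) (a b : T) :
  (f @: [set a; b] = [set f a; f b])%SET.
Proof. by rewrite imsetU1 imset_set1. Qed.

Lemma multigraph_isomorphic_edges (Q1 Q2 : digraph) :
  multigraph_isomorphic (undirected Q1) (undirected Q2) ->
  exists (f : vertex Q1 -> vertex Q2) (h : edge Q1 -> edge Q2),
    [/\ bijective f, bijective h & forall e,
      [set range_map (h e); source_map (h e)]%SET = [set f (range_map e); f (source_map e)]%SET].
Proof.
case=> /= f fb fm; exists f.
pose p1 (e : edge Q1) := [set range_map e; source_map e]%SET.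
pose p2 (e : edge Q2) := [set range_map e; source_map e]%SET.
have [g fg gf] := fb.
have [|h hb hp] := @fiber_bijection (edge Q1) (edge Q2) _ (fun e => f @: p1 e)%SET p2.
  move=> t; have [[a [b tab]]|no] :=
    pselect (exists a b : vertex Q1, t = [set f a; f b]%SET).
    have := fm a b; rewrite /edges_between tab => <-; apply: eq_card => e.
    by rewrite !inE -imset_set2 (inj_eq (imset_inj (can_inj fg))).
  rewrite !eq_card0 // => e; rewrite !inE; apply/negP => /eqP et; apply: no.
    by exists (g (range_map e)), (g (source_map e)); rewrite !gf.
  by exists (range_map e), (source_map e); rewrite -et imset_set2.
by exists h; split=> // e; rewrite -[LHS]/(p2 (h e)) hp imset_set2.
Qed.

Section Families.
Variable R : realType.

Lemma closed_nr (V : normedModType R[i]) (S : set V) :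
  (forall x, (forall e : R, 0 < e -> exists2 y, S y & nr (x - y) < e) -> S x) -> closed S.
Proof.
move=> H x clx; apply: H => e e0.
have e0' : 0 < e%:C by rewrite ltcR.
have [y [Sy xy]] := clx (ball x e%:C) (nbhsx_ballx x e%:C e0').
by exists y => //; apply/nr_ball.
Qed.

Lemma nr_small0 (V : normedModType R[i]) (x : V) : (forall e : R, 0 < e -> nr x <= e) -> x = 0.
Proof.
move=> H; apply: nr_eq0; apply/eqP; rewrite eq_le nr_ge0 andbT leNgt; apply/negP => x0.
have := H _ (divr_gt0 x0 (ltr0n R 2)); lra.
Qed.

(** The set where f and g agree is a C*-subalgebra; it is closed because both morphisms are
    bounded. *)
Lemma star_morphism_eq (A B : cstarAlgType R) (G : set A) (f g : {linear A -> B}) :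
  star_morphism f -> star_morphism g -> cstar_generated G ->
  (forall x, G x -> f x = g x) -> f =1 g.
Proof.
move=> sf sg gen fg x; suff : [set x | f x = g x] = setT by move/seteqP => [_ /(_ x I)].
have [fM fS] := sf; have [gM gS] := sg.
apply: gen => //; split => /= [||a {}x y fx fy|{}x y fx fy|{}x fx].
- apply: closed_nr => {}x H; apply/eqP; rewrite -subr_eq0; apply/eqP/nr_small0 => e e0.
  have [|y /= fy xy] := H (e / 4); first by rewrite divr_gt0.
  have -> : f x - g x = f (x - y) - g (x - y).
    by rewrite [f (_ - _)]linearB [g (_ - _)]linearB fy opprB addrA subrK.
  have := nrB (f (x - y)) (g (x - y)); have := star_morphism_bounded sf (x - y).
  have := star_morphism_bounded sg (x - y); lra.
- by rewrite !linear0.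
- by rewrite !linearP fx fy.
- by rewrite fM gM fx fy.
- by rewrite fS gS fx.
Qed.

(* An edge whose direction the multigraph isomorphism reverses is sent to the
   adjoint of its image. *)
Definition flip_edge (Q1 Q2 : digraph) (A : cstarAlgType R)
    (f : vertex Q1 -> vertex Q2) (h : edge Q1 -> edge Q2) (T : edge Q2 -> A) (e : edge Q1) : A :=
  if (f (range_map e) == range_map (h e)) && (f (source_map e) == source_map (h e))
  then T (h e) else star (T (h e)).

Lemma graph_family_flip (Q1 Q2 : digraph) (A : cstarAlgType R)
    (f : vertex Q1 -> vertex Q2) (h : edge Q1 -> edge Q2) P T :
  (forall e, [set range_map (h e); source_map (h e)]%SET =
             [set f (range_map e); f (source_map e)]%SET) ->
  @graph_family R Q2 A P T -> @graph_family R Q1 A (P \o f) (flip_edge f h T).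
Proof.
move=> hP [Pp T1 PT TP].
have flip e : ((f (range_map e) == range_map (h e)) && (f (source_map e) == source_map (h e)))
    = false -> f (range_map e) = source_map (h e) /\ f (source_map e) = range_map (h e).
  have /setP H := hP e.
  have := H (range_map (h e)); have := H (source_map (h e)).
  have := H (f (range_map e)); have := H (f (source_map e)).
  rewrite !inE !eqxx ?orbT /= => /orP h1 /orP h2 /esym/orP h3 /esym/orP h4.
  move/negbT; rewrite negb_and => h5.
  by case: h1 h2 h3 h4 h5 => /eqP-> [] /eqP-> [] /eqP E3 [] /eqP E4;
    rewrite ?E3 ?E4 ?eqxx ?orbF //= => /orP[] /eqP.
rewrite /graph_family /flip_edge; split=> [v|e|e|e] /=; first exact: Pp.
- by case: ifP => _ //; rewrite nrE nr_star -nrE.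
- case: ifP => [/andP[/eqP-> _]//|/flip[-> _]].
  by have [_ <-] := Pp (source_map (h e)); rewrite -starM TP.
- case: ifP => [/andP[_ /eqP->]//|/flip[_ ->]].
  by have [_ <-] := Pp (range_map (h e)); rewrite -starM PT.
Qed.

Lemma star_morphism_bounded_map (A B : cstarAlgType R) (f : {linear A -> B}) :
  star_morphism f -> bounded_map f.
Proof.
move=> sf; exists 2 => x; have := star_morphism_bounded sf x.
by rewrite -lecR rmorphM /= -!nrE rmorph_nat.
Qed.

Lemma star_morphism_comp (A B C : cstarAlgType R) (f : {linear A -> B}) (g : {linear B -> C}) :
  star_morphism f -> star_morphism g -> star_morphism (g \o f).
Proof.
by move=> [fM fS] [gM gS]; split=> [x y|x] /=; rewrite ?fM ?fS ?gM ?gS.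
Qed.

Lemma flip_morphisms_cancel (Q1 Q2 : digraph) (A1 A2 : cstarAlgType R)
    (P1 : vertex Q1 -> A1) (T1 : edge Q1 -> A1) (P2 : vertex Q2 -> A2) (T2 : edge Q2 -> A2)
    (f : vertex Q1 -> vertex Q2) (f' : vertex Q2 -> vertex Q1)
    (h : edge Q1 -> edge Q2) (h' : edge Q2 -> edge Q1)
    (F : {linear A1 -> A2}) (G : {linear A2 -> A1}) :
  cancel f f' -> cancel f' f -> cancel h h' ->
  cstar_generated (range P1 `|` range T1) -> star_morphism F -> star_morphism G ->
  (forall v, F (P1 v) = P2 (f v)) -> (forall e, F (T1 e) = flip_edge f h T2 e) ->
  (forall v, G (P2 v) = P1 (f' v)) -> (forall e, G (T2 e) = flip_edge f' h' T1 e) ->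
  cancel F G.
Proof.
move=> fK f'K hK gen1 sF sG FP FT GP GT; have [_ GS] := sG.
suff : G \o F =1 idfun by [].
apply: (star_morphism_eq (star_morphism_comp sF sG) _ gen1) => [//|x].
case=> [[v _ <-]|[e _ <-]] /=; first by rewrite FP GP fK.
rewrite FT /flip_edge; case: ifP => he.
  rewrite GT /flip_edge hK -[range_map e]fK -[source_map e]fK.
  by have /andP[/eqP-> /eqP->] := he; rewrite !eqxx.
(* An edge reversed by F is reversed back by G, so the two adjoints cancel. *)
rewrite GS GT /flip_edge hK; case: ifP => he'; last by rewrite starK.
by move: he; have /andP[/eqP<- /eqP<-] := he'; rewrite !f'K !eqxx.
Qed.

Lemma banach_isomorphic_of_multigraph (Q1 Q2 : digraph) (A1 A2 : cstarAlgType R) :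
  is_GCm Q1 A1 -> is_GCm Q2 A2 ->
  multigraph_isomorphic (undirected Q1) (undirected Q2) -> banach_isomorphic A1 A2.
Proof.
move=> [P1 [T1 [fam1 gen1 univ1]]] [P2 [T2 [fam2 gen2 univ2]]].
move=> /multigraph_isomorphic_edges[f [h [[f' fK f'K] [h' hK h'K] hP]]].
have h'P e : [set range_map (h' e); source_map (h' e)]%SET =
    [set f' (range_map e); f' (source_map e)]%SET.
  apply: (imset_inj (can_inj fK)); rewrite !imset_set2 !f'K.
  by rewrite -hP h'K.
have [F [sF FP FT]] := univ1 _ _ _ (graph_family_flip hP fam2).
have [G [sG GP GT]] := univ2 _ _ _ (graph_family_flip h'P fam1).
exists F, G; split; first by case: sF.
- exact: flip_morphisms_cancel fK f'K hK gen1 sF sG FP FT GP GT.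
- exact: flip_morphisms_cancel f'K fK h'K gen2 sG sF GP GT FP FT.
- exact: star_morphism_bounded_map.
- exact: star_morphism_bounded_map.
Qed.

End Families.

(** * Continuous families of *-morphisms *)

Section NormContinuity.
Variables (R : realType) (X : topologicalType).

Definition nr_continuous (V : normedModType R[i]) (F : X -> V) : Prop :=
  forall x (e : R), 0 < e -> \forall y \near x, nr (F x - F y) < e.

Lemma nr_continuous_cst (V : normedModType R[i]) (a : V) : nr_continuous (fun=> a).
Proof. by move=> x e e0; apply: nearW => y; rewrite subrr nr0. Qed.

Lemma nr_continuousP (V : normedModType R[i]) (c : R[i]) (F G : X -> V) :
  nr_continuous F -> nr_continuous G -> nr_continuous (fun x => c *: F x + G x).
Proof.
move=> cF cG x e e0; have c0 := modc_ge0 c.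
have d0 : 0 < e / (2 * (modc c + 1)) by rewrite divr_gt0 // mulr_gt0 // ltr_wpDl.
near=> y; rewrite opprD addrACA -scalerBr (le_lt_trans (nrD _ _)) // nrZ.
have h1 : nr (F x - F y) < e / (2 * (modc c + 1)) by near: y; exact: cF.
have h2 : nr (G x - G y) < e / 2 by near: y; apply: cG; rewrite divr_gt0.
have h3 := nr_ge0 (F x - F y).
have : nr (F x - F y) * (2 * (modc c + 1)) < e.
  by rewrite -ltr_pdivlMr // mulr_gt0 // ltr_wpDl.
nra.
Unshelve. all: by end_near. Qed.

Lemma nr_continuous_bmul (B : banachAlgType R) (F G : X -> B) :
  nr_continuous F -> nr_continuous G -> nr_continuous (fun x => bmul (F x) (G x)).
Proof.
move=> cF cG x e e0; set a := nr (F x); set b := nr (G x).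
have a0 : 0 <= a := nr_ge0 _; have b0 : 0 <= b := nr_ge0 _.
pose d := Num.min 1 (e / (2 * (a + b + 1))).
have ab0 : 0 < 2 * (a + b + 1) by rewrite mulr_gt0 // ltr_wpDl ?addr_ge0.
have d0 : 0 < d by rewrite lt_min ltr01 divr_gt0.
have d1 : d <= 1 by rewrite ge_min lexx.
have de : d * (2 * (a + b + 1)) <= e by rewrite -ler_pdivlMr // ge_min lexx orbT.
near=> y.
have h1 : nr (F x - F y) < d by near: y; exact: cF.
have h2 : nr (G x - G y) < d by near: y; exact: cG.
have -> : bmul (F x) (G x) - bmul (F y) (G y) =
    bmul (F x) (G x - G y) + bmul (F x - F y) (G y).
  by rewrite bmulDr bmulDl bmulNr bmulNl addrA subrK.
have h3 := nrD (bmul (F x) (G x - G y)) (bmul (F x - F y) (G y)).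
have h4 := nr_bmul (F x) (G x - G y); have h5 := nr_bmul (F x - F y) (G y).
have h6 : nr (G y) <= b + nr (G x - G y).
  by have := nrB (G x) (G x - G y); rewrite opprB addrC subrK.
have h7 := nr_ge0 (F x - F y); have h8 := nr_ge0 (G x - G y).
have h9 : nr (F x - F y) * nr (G y) <= d * (b + 1).
  by rewrite ler_pM ?nr_ge0 // ?(ltW h1) // (le_trans h6) // lerD2l ltW // (lt_le_trans h2).
have h10 : a * nr (G x - G y) <= a * d by rewrite ler_wpM2l // ltW.
rewrite -/a in h4; nra.
Unshelve. all: by end_near. Qed.

Lemma nr_continuous_star (B : cstarAlgType R) (F : X -> B) :
  nr_continuous F -> nr_continuous (fun x => star (F x)).
Proof.
move=> cF x e e0; near=> y; suff -> : star (F x) - star (F y) = star (F x - F y).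
  by rewrite nr_star; near: y; exact: cF.
by rewrite -[- F y]scaleN1r starD starZ rmorphN1 scaleN1r.
Unshelve. all: by end_near. Qed.

(** The elements with a continuous orbit form a C*-subalgebra; it is closed because the bound on
    [p x] does not depend on x. *)
Lemma nr_continuous_family (A B : cstarAlgType R) (p : X -> {linear A -> B}) (G : set A) :
  (forall x, star_morphism (p x)) -> cstar_generated G ->
  (forall a, G a -> nr_continuous (fun x => p x a)) ->
  forall a, nr_continuous (fun x => p x a).
Proof.
move=> sp gen pG a; suff : [set a | nr_continuous (fun x => p x a)] = setT.
  by move/seteqP => [_ /(_ a I)].
apply: gen => //; split=> [|||b c /= cb cc|b /= cb].
- apply: closed_nr => {}a H x e e0.
  have [|b /= cb ab] := H (e / 8); first by rewrite divr_gt0.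
  near=> y.
  have h1 : nr (p x b - p y b) < e / 8 by near: y; apply: cb; rewrite divr_gt0.
  have -> : p x a - p y a = (p x (a - b) + (p x b - p y b)) - p y (a - b).
    by rewrite [p x (_ - _)]linearB [p y (_ - _)]linearB addrA subrK opprB addrA subrK.
  have := nrB (p x (a - b) + (p x b - p y b)) (p y (a - b)).
  have := nrD (p x (a - b)) (p x b - p y b).
  have := star_morphism_bounded (sp x) (a - b).
  have := star_morphism_bounded (sp y) (a - b).
  lra.
- rewrite /= (_ : (fun x => _) = fun=> 0); first exact: nr_continuous_cst.
  by apply/funext => x; rewrite linear0.
- move=> c u v /= cu cv; rewrite (_ : (fun x => _) = fun x => c *: p x u + p x v).
    exact: nr_continuousP.
  by apply/funext => x; rewrite linearP.
- rewrite (_ : (fun x => _) = fun x => bmul (p x b) (p x c)).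
    exact: nr_continuous_bmul.
  by apply/funext => x; case: (sp x) => ->.
- rewrite (_ : (fun x => _) = fun x => star (p x b)).
    exact: nr_continuous_star.
  by apply/funext => x; case: (sp x) => _ ->.
Unshelve. all: by end_near. Qed.

End NormContinuity.

(** * Characters *)

Section Characters.
Variables (R : realType) (A : cstarAlgType R).

(** The zero functional is included: it is the character of the empty set of vertices. *)
Definition character (A' : banachAlgType R) (chi : A' -> R[i]) : Prop :=
  (forall (c : R[i]) x y, chi (c *: x + y) = c * chi x + chi y) /\
  (forall x y, chi (bmul x y) = chi x * chi y).

Variable chi : A -> R[i].
Hypothesis chiP : character chi.

Lemma character0 : chi 0 = 0.
Proof.
have [chiL _] := chiP; have := chiL (-1) 0 0.
by rewrite scaler0 addr0 mulN1r addNr.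
Qed.

Lemma characterZ c x : chi (c *: x) = c * chi x.
Proof. by have [chiL _] := chiP; rewrite -[_ *: x]addr0 chiL character0 addr0. Qed.

Lemma characterD x y : chi (x + y) = chi x + chi y.
Proof. by have [chiL _] := chiP; rewrite -[x]scale1r chiL scale1r mul1r. Qed.

Lemma characterB x y : chi (x - y) = chi x - chi y.
Proof. by rewrite characterD -scaleN1r characterZ mulN1r. Qed.

(* If the multiplication operator y |-> x y + c y has norm < |chi x + c|, the
   Neumann series of its multiple by (chi x + c)^-1 provides z = y + L z, and
   chi (L z) = chi z, so that chi vanishes at every y. *)
Lemma character_affine_le x (c : R[i]) (N : R) : 0 <= N ->
  (forall y, nr (bmul x y + c *: y) <= N * nr y) -> (exists y, chi y != 0) ->
  modc (chi x + c) <= N.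
Proof.
move=> N0 xcN [y /eqP y0]; rewrite leNgt; apply/negP => Nl; apply: y0.
have [_ chiM] := chiP; set l := chi x + c in Nl *.
have l0 : 0 < modc l by exact: le_lt_trans Nl.
have ln0 : l != 0 by apply: contraTneq l0 => ->; rewrite modc0 ltxx.
have [z zE] : exists z, z = y + l^-1 *: (bmul x z + c *: z).
  apply: (affine_fixed_point (q := N / modc l) y) => [|u v|u].
  - by rewrite divr_ge0 ?modc_ge0 // ltr_pdivrMr // mul1r.
  - by rewrite -scalerBr bmulDr bmulNr [c *: (u - v)]scalerBr opprD addrACA.
  - by rewrite nrZ modcV mulrC mulrAC ler_wpM2r ?invr_ge0 ?modc_ge0.
have := congr1 chi zE; rewrite characterD characterZ characterD characterZ chiM.
by rewrite -mulrDl -/l mulKf // => /eqP; rewrite -subr_eq subrr eq_sym => /eqP.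
Qed.

Lemma character_le x : modc (chi x) <= nr x.
Proof.
have [[y y0]|no] := pselect (exists y, chi y != 0).
  rewrite -[chi x]addr0; apply: character_affine_le; last by exists y.
    exact: nr_ge0.
  by move=> z; rewrite scale0r addr0 nr_bmul.
have -> : chi x = 0 by apply/eqP; apply: contrapT => /negP h; apply: no; exists x.
by rewrite modc0 nr_ge0.
Qed.

(* For x self-adjoint, |x y + i s y|^2 <= (|x|^2 + s^2) |y|^2, so that
   |chi x + i s|^2 <= |x|^2 + s^2 for every real s. *)
Lemma character_selfadjoint x : star x = x -> complex.Im (chi x) = 0.
Proof.
move=> xs; have [[y y0]|no] := pselect (exists y, chi y != 0); last first.
  have -> // : chi x = 0 by apply/eqP; apply: contrapT => /negP h; apply: no; exists x.
have le (s : R) : modc (chi x + 0 +i* s) ^+ 2 <= nr x ^+ 2 + s ^+ 2.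
  have N0 : 0 <= nr x ^+ 2 + s ^+ 2 by rewrite addr_ge0 ?sqr_ge0.
  rewrite -[leRHS]sqr_sqrtr // ler_sqr ?nnegrE ?modc_ge0 ?sqrtr_ge0 //.
  apply: character_affine_le; [exact: sqrtr_ge0| |by exists y].
  move=> z; rewrite -(ler_pXn2r (n := 2)) ?nnegrE ?mulr_ge0 ?sqrtr_ge0 ?nr_ge0 //.
  rewrite exprMn sqr_sqrtr // -[leLHS]nr_star_sqr.
  have dd : Num.conj (0 +i* s) = - (0 +i* s) :> R[i] by apply/eqP; rewrite eq_complex /= ?oppr0 !eqxx.
  have d2 : (0 +i* s) * (0 +i* s) = - (s ^+ 2)%:C :> R[i] by simpc; rewrite expr2.
  move: (0 +i* s : R[i]) dd d2 => d dd d2.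
  have -> : bmul (star (bmul x z + d *: z)) (bmul x z + d *: z) =
      bmul (star z) (bmul (bmul x x) z) + ((s ^+ 2)%:C) *: bmul (star z) z.
    rewrite starD starM starZ xs dd bmulDl !bmulDr !bmulZl !bmulZr !bmulA.
    by rewrite scalerA mulNr d2 opprK scaleNr addrA addrK.
  rewrite (le_trans (nrD _ _)) // nrZ nr_star_sqr modc_real ger0_norm ?sqr_ge0 //.
  rewrite mulrDl lerD2r.
  have h1 := nr_bmul (star z) (bmul (bmul x x) z); rewrite nr_star in h1.
  have h2 := nr_bmul (bmul x x) z; have h3 := nr_bmul x x.
  have h4 : nr (bmul x x) * nr z <= nr x * nr x * nr z by rewrite ler_wpM2r ?nr_ge0.
  rewrite (le_trans h1) // expr2 [in leRHS]expr2 mulrA mulrC ler_wpM2r ?nr_ge0 //.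
  exact: le_trans h2 h4.
(* For b = Im (chi x), N = nr x ^ 2 and b s = N, the inequality (b + s)^2 <= N + s^2 reads 2 N + b^2
   <= N. *)
apply: contrapT => /eqP b0; have := le (nr x ^+ 2 / complex.Im (chi x)).
rewrite modc_sqr !raddfD /=; set b := complex.Im (chi x) in b0 *.
set N := nr x ^+ 2; have N0 : 0 <= N by exact: sqr_ge0.
have bs : b * (N / b) = N by rewrite mulrC divfK.
have b2 : 0 < b ^+ 2 by rewrite lt_def sqr_ge0 sqrf_eq0 b0.
have := sqr_ge0 (complex.Re (chi x) + 0); move: (N / b) bs => s bs.
nra.
Qed.

Lemma character_star x : chi (star x) = Num.conj (chi x).
Proof.
have h1 : complex.Im (chi (x + star x)) = 0.
  by apply: character_selfadjoint; rewrite starD starK addrC.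
have h2 : complex.Im (chi ('i%C *: (x - star x))) = 0.
  apply: character_selfadjoint.
  have ci : Num.conj 'i%C = - 'i%C :> R[i] by apply/eqP; rewrite eq_complex /= ?oppr0 !eqxx.
  have sB : star (x - star x) = star x - x.
    by rewrite -scaleN1r starD starZ starK rmorphN1 scaleN1r.
  by rewrite starZ ci sB scaleNr -scalerN opprB.
move: h1 h2; rewrite characterD characterZ characterB.
case: (chi x) => a b; case: (chi (star x)) => c d; simpc => /= h1 h2.
by congr (_ +i* _); lra.
Qed.

End Characters.

Lemma continuous_nat_constant (R : realType) (f : R -> R) (a b : R) : a <= b ->
  continuous f -> (forall x, exists n : nat, f x = n%:R) -> f a = f b.
Proof.
move=> ab cf fn; apply/eqP/negPn/negP => fab.
have [[n fa] [m fb]] := (fn a, fn b).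
pose k := minn n m.
have cw : {within `[a, b], continuous f} by exact: continuous_subspaceT.
have [|c _ fc] := @IVT R f a b (k%:R + 2^-1) ab cw.
  rewrite fa fb /k; move: fab; rewrite fa fb eqr_nat => nm.
  rewrite /Order.min /Order.max /=.
  have half : 0 < 2^-1 :> R /\ 2^-1 < 1 :> R by split; lra.
  have [lt|lt|/eqP] := ltngtP n m; last by rewrite (negbTE nm).
  - have -> : (n%:R < m%:R :> R) by rewrite ltr_nat.
    have := lt; rewrite -(ler_nat R) -natr1; lra.
  - have -> : (n%:R < m%:R :> R) = false by rewrite ltr_nat ltnNge ltnW.
    have := lt; rewrite -(ler_nat R) -natr1; lra.
have [l fl] := fn c; move: fc; rewrite fl => /eqP.
have -> : (l%:R == k%:R + 2^-1 :> R) = ((2 * l)%:R == (2 * k + 1)%:R :> R).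
  rewrite natrD !natrM; apply/eqP/eqP => h; lra.
by rewrite eqr_nat => /eqP; lia.
Qed.

(** Entry (0, 1) of p p = p reads (p00 + p11) p01 = p01: either the trace is 1, or p is triangular
    and its diagonal entries are idempotent. *)
Lemma idempotent_mx2_trace (F : fieldType) (p : 'M[F]_2) : p *m p = p ->
  exists n : nat, p 0 0 + p 1 1 = n%:R.
Proof.
move=> /matrixP pp; have E i j : p i 0 * p 0 j + p i 1 * p 1 j = p i j.
  by have := pp i j; rewrite mxE big_ord_recl big_ord1 (_ : lift _ _ = 1) //; apply: val_inj.
have E00 := E 0 0; have E01 := E 0 1; have E10 := E 1 0; have E11 := E 1 1.
have [t1|t1] := eqVneq (p 0 0 + p 1 1) 1; first by exists 1%N.
have b0 : p 0 1 = 0.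
  apply: contra_neq_eq t1 => b0; apply: (mulIf b0); rewrite mul1r mulrDl -[RHS]E01; ring.
have idem (x : F) : x * x = x -> exists n : nat, x = n%:R.
  move=> xx; have [->|x0] := eqVneq x 0; first by exists 0%N.
  by exists 1%N; apply: (mulIf x0); rewrite mul1r.
have [n nE] := idem (p 0 0) ltac:(by rewrite -[RHS]E00 b0 mul0r addr0).
have [m mE] := idem (p 1 1) ltac:(by rewrite -[RHS]E11 b0 mulr0 add0r).
by exists (n + m)%N; rewrite nE mE natrD.
Qed.

Section MatrixFamilies.
Variable R : realType.

Lemma nr_continuous_opmx (X : topologicalType) n (F : X -> opmx R n) :
  (forall i j x (e : R), 0 < e -> \forall y \near x, modc (F x i j - F y i j) < e) ->
  nr_continuous F.
Proof.
move=> cF x e e0; pose N := (n.+1 * n.+1)%N.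
pose d := e / N.+1%:R; have d0 : 0 < d by rewrite divr_gt0.
have h : \forall y \near x, forall ij : 'I_n.+1 * 'I_n.+1, modc ((F x - F y) ij.1 ij.2) < d.
  by apply: filter_forall => -[i j]; near=> y; rewrite !mxE; near: y; exact: cF.
near=> y; rewrite nr_opmx.
have hy : forall ij : 'I_n.+1 * 'I_n.+1, modc ((F x - F y) ij.1 ij.2) < d by near: y.
apply: (@le_lt_trans _ _ (\sum_(i < n.+1) \sum_(j < n.+1) d)).
  apply: le_trans (opn_le_entries _) _.
  by apply: ler_sum => i _; apply: ler_sum => j _; exact: ltW (hy (i, j)).
have dE : e = d * N.+1%:R by rewrite /d divfK // pnatr_eq0.
by rewrite !sumr_const !card_ord -mulrnA -[ltLHS]mulr_natr [ltRHS]dE ltr_pM2l // ltr_nat.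
Unshelve. all: by end_near. Qed.

Lemma entry_le_nr n (a b : opmx R n) i j : modc (a i j - b i j) <= nr (a - b).
Proof. by rewrite nr_opmx; have := entry_le_opn (a - b) i j; rewrite !mxE. Qed.

Lemma nr_scalar_opmx n (c : R[i]) : nr (c%:M : opmx R n) <= modc c.
Proof.
rewrite nr_opmx; apply: opn_le => [|u]; first exact: modc_ge0.
by rewrite mul_mx_scalar rvnZ.
Qed.

Variables (A : cstarAlgType R) (n : nat) (p : {linear A -> opmx R n}) (G : set A).
Hypotheses (sp : star_morphism p) (gen : cstar_generated G).
Hypothesis diag : forall a i j, G a -> i != j -> p a i j = 0.

Lemma diagonal_image a i j : i != j -> p a i j = 0.
Proof.
move: i j; suff : [set a | forall i j, i != j -> p a i j = 0] = setT.
  by move/seteqP => [_ /(_ a I)].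
have [pM pS] := sp; apply: gen => [|{}a Ga i j]; last exact: diag.
split=> [|i j _|c u v /= hu hv i j ij|u v /= hu hv i j ij|u /= hu i j ij].
- apply: closed_nr => {}a H i j ij; apply/eqP; rewrite -normr_eq0 modcE.
  suff -> : modc (p a i j) = 0 by [].
  apply/eqP; rewrite eq_le modc_ge0 andbT leNgt; apply/negP => a0.
  have [|b /= hb ab] := H (modc (p a i j) / 4); first by rewrite divr_gt0.
  have := entry_le_nr (p a) (p b) i j; rewrite -linearB hb // subr0.
  have := star_morphism_bounded sp (a - b); lra.
- by rewrite linear0 mxE.
- by rewrite linearP !mxE hu // hv // mulr0 addr0.
- rewrite pM mxE big1 // => k _; have [->|ik] := eqVneq k j.
    by rewrite hu // mul0r.
  by rewrite hv // mulr0.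
- by rewrite pS !mxE hu ?conjC0 // eq_sym.
Qed.

Lemma diagonal_character i : character (fun a => p a i i).
Proof.
have [pM _] := sp; split=> [c x y|x y]; first by rewrite linearP !mxE.
rewrite pM mxE (bigD1 i) //= big1 ?addr0 // => k ki.
by rewrite diagonal_image ?mul0r // eq_sym.
Qed.

End MatrixFamilies.

(** * Characters of the universal algebra *)

Section UniversalCharacters.
Variables (R : realType) (Q : digraph) (A : cstarAlgType R).
Variables (P : vertex Q -> A) (T : edge Q -> A).
Implicit Types (S : {set vertex Q}) (z : edge Q -> R[i]).

(** A point of the polydisc of S, extended by 0 to the edges without both ends in S, so that one
    type serves all S. *)
Definition admissible S z : Prop := forall e, modc (z e) <= 1 /\
  (z e != 0 -> (range_map e \in S) /\ (source_map e \in S)).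

Lemma admissible0 S : admissible S (fun=> 0).
Proof. by move=> e; rewrite modc0 ler01 eqxx. Qed.

Hypothesis fam : graph_family P T.
Hypothesis gen : cstar_generated (range P `|` range T).
Hypothesis univ : forall (B : cstarAlgType R) (P' : vertex Q -> B) (T' : edge Q -> B),
  graph_family P' T' -> exists f : {linear A -> B},
    [/\ star_morphism f, forall v, f (P v) = P' v & forall e, f (T e) = T' e].

Lemma character_eq (chi chi' : A -> R[i]) : character chi -> character chi' ->
  (forall v, chi (P v) = chi' (P v)) -> (forall e, chi (T e) = chi' (T e)) -> chi =1 chi'.
Proof.
move=> cc cc' eP eT a; suff : [set a | chi a = chi' a] = setT by move/seteqP => [_ /(_ a I)].
apply: gen => [|b]; last by case=> [[v _ <-]|[e _ <-]].
split=> [||c u v /= hu hv|u v /= hu hv|u /= hu].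
- apply: closed_nr => {}a H; apply/eqP; rewrite -subr_eq0 -normr_eq0 modcE.
  suff -> : modc (chi a - chi' a) = 0 by [].
  apply/eqP; rewrite eq_le modc_ge0 andbT leNgt; apply/negP => a0.
  have [|b /= hb ab] := H (modc (chi a - chi' a) / 4); first by rewrite divr_gt0.
  have : modc (chi a - chi' a) <= modc (chi (a - b)) + modc (chi' (a - b)).
    rewrite -(modcN (chi' _)) (le_trans _ (modcD _ _)) //.
    by rewrite !characterB // hb opprB addrA subrK.
  have := character_le cc (a - b); have := character_le cc' (a - b); lra.
- by rewrite /= !character0.
- by rewrite /= (proj1 cc) (proj1 cc') hu hv.
- by rewrite (proj2 cc) (proj2 cc') hu hv.
- by rewrite !character_star // hu.
Qed.

(** P v is idempotent, so its value is 0 or 1; T e = P T e = T e P forces the value 0 as soon as an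
    end of e is outside the support. *)
Lemma admissible_character (chi : A -> R[i]) : character chi ->
  admissible [set v | chi (P v) == 1]%SET (chi \o T) /\
  forall v, chi (P v) = (v \in [set v | chi (P v) == 1]%SET)%:R.
Proof.
move=> cc; have [Pp T1 PT TP] := fam; have [_ cM] := cc.
have chiP v : chi (P v) = (v \in [set v | chi (P v) == 1]%SET)%:R.
  rewrite inE; case: eqVneq => [->//|Pv]; have := cM (P v) (P v).
  by rewrite (proj1 (Pp v)) => /esym E; apply: contra_neq_eq Pv => P0; apply: (mulIf P0); rewrite E mul1r.
split=> // e; split=> [|/= Te0].
  by rewrite (le_trans (character_le cc _)) //= -lecR -nrE.
split; apply: contraNT Te0 => nS.
  by rewrite -PT cM chiP (negbTE nS) mul0r.
by rewrite -TP cM chiP (negbTE nS) mulr0.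
Qed.

(** [opmx R 0] plays the role of the C*-algebra of complex numbers, to which the universal property
    applies. *)
Lemma universal_character S z : admissible S z -> exists p : {linear A -> opmx R 0},
  [/\ star_morphism p, forall v, p (P v) = ((v \in S)%:R%:M : opmx R 0) &
      forall e, p (T e) = ((z e)%:M : opmx R 0)].
Proof.
move=> adm; apply: univ; rewrite /graph_family.
have mulS (a b : R[i]) : bmul (a%:M : opmx R 0) (b%:M : opmx R 0) = ((a * b)%:M : opmx R 0).
  exact: (esym (scalar_mxM _ _ _)).
split=> [v|e|e|e] /=.
- split; first by rewrite mulS; case: (_ \in _); rewrite ?mulr1 ?mulr0.
  by apply/matrixP => i j; rewrite !mxE; case: (_ \in _); case: (_ == _) (eq_sym i j) => <-;
    rewrite ?mulr0n ?conjC0 // conjC1.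
- have [z1 _] := adm e; rewrite nrE lecR (le_trans (nr_scalar_opmx 0 (z e))) //.
- have [_] := adm e; have [-> _|z0 /(_ isT)[-> _]] := eqVneq (z e) 0; rewrite mulS ?mulr0 //.
  by rewrite mul1r.
- have [_] := adm e; have [-> _|z0 /(_ isT)[_ ->]] := eqVneq (z e) 0; rewrite mulS ?mul0r //.
  by rewrite mulr1.
Qed.

Definition character_parametrization
    (chi : {set vertex Q} -> (edge Q -> R[i]) -> A -> R[i]) : Prop :=
  forall S z, admissible S z ->
  [/\ character (chi S z), forall v, chi S z (P v) = (v \in S)%:R &
      forall e, chi S z (T e) = z e].

Lemma parametrized_representation : exists p : {set vertex Q} -> (edge Q -> R[i]) ->
    {linear A -> opmx R 0},
  character_parametrization (fun S z a => p S z a 0 0) /\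
  forall S z, admissible S z ->
  [/\ star_morphism (p S z), forall v, p S z (P v) = ((v \in S)%:R%:M : opmx R 0) &
      forall e, p S z (T e) = ((z e)%:M : opmx R 0)].
Proof.
have [p0 _] := universal_character (admissible0 finset.set0).
have /choice[p pP] : forall Sz : {set vertex Q} * (edge Q -> R[i]),
    exists p : {linear A -> opmx R 0}, admissible Sz.1 Sz.2 ->
    [/\ star_morphism p, forall v, p (P v) = ((v \in Sz.1)%:R%:M : opmx R 0) &
      forall e, p (T e) = ((Sz.2 e)%:M : opmx R 0)].
  move=> [S z]; have [/universal_character[p pP]|nadm] := pselect (admissible S z).
    by exists p.
  by exists p0.
exists (fun S z => p (S, z)); split=> S z adm; have [ps pV pT] := pP (S, z) adm; last by split.
split=> [|v|e]; last 2 first.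
- by rewrite pV mxE eqxx mulr1n.
- by rewrite pT mxE eqxx mulr1n.
by apply: (diagonal_character ps gen) => a i j _; rewrite !ord1 eqxx.
Qed.

(** Serves with X the real line, for contracting a polydisc, and with X a space of row vectors, for
    the invariance of dimension. *)
Lemma character_continuous (chi : {set vertex Q} -> (edge Q -> R[i]) -> A -> R[i])
    (X : topologicalType) S (z : X -> edge Q -> R[i]) :
  character_parametrization chi -> (forall x, admissible S (z x)) ->
  (forall i x (e : R), 0 < e -> \forall y \near x, modc (z x i - z y i) < e) ->
  forall a x (e : R), 0 < e -> \forall y \near x, modc (chi S (z x) a - chi S (z y) a) < e.
Proof.
move=> chiP adm zc a x e e0; have [p [pchi pP]] := parametrized_representation.
have chiE y : chi S (z y) a = p S (z y) a 0 0.
  have [c1 cP1 cT1] := chiP _ _ (adm y); have [c2 cP2 cT2] := pchi _ _ (adm y).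
  by apply: (character_eq c1 c2) => [v|i]; rewrite ?cP1 ?cP2 ?cT1 ?cT2.
have pc : forall a, nr_continuous (fun y => p S (z y) a).
  apply: (nr_continuous_family (G := range P `|` range T)) => // [y|b].
    by have [] := pP _ _ (adm y).
  case=> [[v _ <-]|[i _ <-]].
    rewrite (_ : (fun y => _) = fun=> ((v \in S)%:R%:M : opmx R 0)).
      exact: nr_continuous_cst.
    by apply/funext => y; have [_ -> _] := pP _ _ (adm y).
  rewrite (_ : (fun y => _) = fun y => ((z y i)%:M : opmx R 0)).
    apply: nr_continuous_opmx => k j y d d0; rewrite !ord1.
    near=> w; rewrite !mxE eqxx !mulr1n; near: w; exact: zc.
  by apply/funext => y; have [_ _ ->] := pP _ _ (adm y).
near=> y; rewrite !chiE; apply: le_lt_trans (entry_le_nr _ _ _ _) _.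
by near: y; exact: pc.
Unshelve. all: by end_near. Qed.

Section Idempotent.
Variables (chi : {set vertex Q} -> (edge Q -> R[i]) -> A -> R[i]) (a : A).
Hypotheses (chiP : character_parametrization chi) (aa : bmul a a = a).

Lemma character_idempotent S z : admissible S z -> exists b : bool, chi S z a = b%:R.
Proof.
move=> /chiP[[_ cM] _ _]; have := cM a a; rewrite aa => E.
have [->|c0] := eqVneq (chi S z a) 0; first by exists false.
by exists true; apply: (mulIf c0); rewrite mul1r -E.
Qed.

Lemma cos_near (x e : R) : 0 < e -> \forall y \near x, `|cos x - cos y| < e.
Proof. by move=> e0; have /cvgrPdist_lt/(_ e e0) := @continuous_cos R x. Qed.

Lemma sin_near (x e : R) : 0 < e -> \forall y \near x, `|sin x - sin y| < e.
Proof. by move=> e0; have /cvgrPdist_lt/(_ e e0) := @continuous_sin R x. Qed.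

Lemma character_idempotent_constant S z : admissible S z ->
  chi S z a = chi S (fun=> 0) a.
Proof.
(* The cosine keeps the path in the polydisc for every real t; it leads from z at t = 0 to the
   centre at t = pi / 2. *)
move=> adm; pose zt (t : R) e := (cos t)%:C * z e.
have admt t : admissible S (zt t).
  move=> e; have [z1 zS] := adm e; split.
    by rewrite /zt modcM modc_real mulr_ile1 ?modc_ge0 // ler_norml cos_geN1 cos_le1.
  by rewrite /zt mulf_eq0 negb_or => /andP[_ /zS].
have ct : forall x (e : R), 0 < e -> \forall y \near x, modc (chi S (zt x) a - chi S (zt y) a) < e.
  apply: character_continuous => // i x e e0; near=> y.
  rewrite /zt -mulrBl -rmorphB modcM modc_real (@le_lt_trans _ _ `|cos x - cos y|) //.
    by rewrite ler_piMr //; case: (adm i).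
  by near: y; exact: cos_near.
have fE : complex.Re (chi S (zt 0) a) = complex.Re (chi S (zt (pi / 2)) a).
  apply: (@continuous_nat_constant R (fun t => complex.Re (chi S (zt t) a))).
  - by rewrite divr_ge0 // pi_ge0.
  - move=> x; apply/cvgrPdist_lt => e e0; near=> y; rewrite -raddfB.
    by apply: le_lt_trans (Re_le_modc _) _; near: y; exact: ct.
  - by move=> x; have [b ->] := character_idempotent (admt x); exists b; case: b.
have z0 : zt 0 = z by apply/funext => e; rewrite /zt cos0 mul1r.
have z1 : zt (pi / 2) = fun=> 0 by apply/funext => e; rewrite /zt cos_pihalf mul0r.
rewrite z0 z1 in fE; have [b bE] := character_idempotent adm.
have [b' bE'] := character_idempotent (admissible0 S).
move: fE; rewrite bE bE'; case: b b' {bE bE'} => [] [] //= /eqP; rewrite ?oner_eq0 // eq_sym oner_eq0 //.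
Unshelve. all: by end_near. Qed.

(* With rotation angle t, the projections of the vertices of S' move from the
   first to the second basis vector of C^2; the trace of the idempotent a is
   constant along this path of representations. *)
Lemma character_idempotent_additive S S' : (forall v, v \in S -> v \notin S') ->
  chi (S :|: S')%SET (fun=> 0) a = chi S (fun=> 0) a + chi S' (fun=> 0) a.
Proof.
move=> dis.
pose w (t : R) (i : 'I_2) : R := if i == 0 then cos t else sin t.
have ww t : w t 0 * w t 0 + w t 1 * w t 1 = 1 by rewrite /w -!expr2 cos2Dsin2.
(* The orthogonal projection onto the line spanned by (cos t, sin t). *)
pose q t : opmx R 1 := \matrix_(i, j) (w t i * w t j)%:C.
have qq t : bmul (q t) (q t) = q t.
  apply/matrixP => i j; rewrite !mxE big_ord_recl big_ord1 (_ : lift _ _ = 1); last exact: val_inj.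
  rewrite !mxE -!rmorphM -rmorphD /=; congr (_%:C).
  by rewrite -[RHS]mulr1 -(ww t); ring.
have qs t : star (q t) = q t.
  by apply/matrixP => i j; rewrite !mxE mulrC; exact: conjc_real.
pose Pt t v : opmx R 1 := if v \in S then q 0 else if v \in S' then q t else 0.
have famt t : graph_family (Pt t) (fun _ : edge Q => 0 : opmx R 1).
  rewrite /graph_family; split=> [v|e|e|e]; rewrite ?bmul0l ?bmul0r ?normr0 ?ler01 //.
  rewrite /Pt; case: ifP => _; [by split|case: ifP => _; first by split].
  by split; rewrite ?bmul0l //; apply/matrixP => i j; rewrite !mxE conjC0.
have /choice[p pP] := fun t => univ (famt t).
have sp t : star_morphism (p t) by have [] := pP t.
have pc : forall b, nr_continuous (fun t => p t b).
  apply: (nr_continuous_family sp gen) => b [[v _ <-]|[e _ <-]]; last first.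
    rewrite (_ : (fun t => _) = fun=> 0); first exact: nr_continuous_cst.
    by apply/funext => t; have [_ _ ->] := pP t.
  rewrite (_ : (fun t => _) = fun t => Pt t v); last first.
    by apply/funext => t; have [_ -> _] := pP t.
  case vS : (v \in S).
    rewrite (_ : Pt^~ v = fun=> q 0); first exact: nr_continuous_cst.
    by apply/funext => t; rewrite /Pt vS.
  case vS' : (v \in S'); last first.
    rewrite (_ : Pt^~ v = fun=> 0); first exact: nr_continuous_cst.
    by apply/funext => t; rewrite /Pt vS vS'.
  rewrite (_ : Pt^~ v = q); last by apply/funext => t; rewrite /Pt vS vS'.
  apply: nr_continuous_opmx => i j x e e0.
  have w1 t k : `|w t k| <= 1.
    by rewrite /w; case: ifP => _; rewrite ler_norml ?cos_geN1 ?cos_le1 ?sin_geN1 ?sin_le1.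
  have wn k (d : R) : 0 < d -> \forall y \near x, `|w x k - w y k| < d.
    by move=> d0; rewrite /w; case: ifP => _; [exact: cos_near|exact: sin_near].
  have e2 : 0 < e / 2 by rewrite divr_gt0.
  near=> y; rewrite !mxE -rmorphB modc_real.
  have -> : w x i * w x j - w y i * w y j = (w x i - w y i) * w x j + w y i * (w x j - w y j) by ring.
  rewrite (le_lt_trans (ler_normD _ _)) // !normrM.
  have h1 : `|w x i - w y i| < e / 2 by near: y; exact: wn.
  have h2 : `|w x j - w y j| < e / 2 by near: y; exact: wn.
  have h3 : `|w x i - w y i| * `|w x j| <= `|w x i - w y i| by rewrite ler_piMr.
  have h4 : `|w y i| * `|w x j - w y j| <= `|w x j - w y j| by rewrite ler_piMl.
  lra.
(* Applied at t = 0 and t = pi / 2, where the representation is diagonal and its two diagonal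
   entries are characters. *)
have traceE t S1 S2 : (forall v, Pt t v = \matrix_(i, j)
      ((i == j) && (if i == 0 then v \in S1 else v \in S2))%:R) ->
    p t a 0 0 + p t a 1 1 = chi S1 (fun=> 0) a + chi S2 (fun=> 0) a.
  move=> PtE; have [_ pV pT] := pP t.
  have diag b i j : (range P `|` range T) b -> i != j -> p t b i j = 0.
    case=> [[v _ <-]|[e _ <-]] /negbTE ij; last by rewrite pT mxE.
    by rewrite pV PtE mxE ij.
  have dc := diagonal_character (sp t) gen diag.
  have [c1 cP1 cT1] := chiP (admissible0 S1); have [c2 cP2 cT2] := chiP (admissible0 S2).
  congr (_ + _).
    by apply: (character_eq (dc 0) c1) => [v|e]; rewrite ?cP1 ?cT1 ?pV ?pT ?PtE mxE.
  by apply: (character_eq (dc 1) c2) => [v|e]; rewrite ?cP2 ?cT2 ?pV ?pT ?PtE mxE.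
have tE : complex.Re (p 0 a 0 0 + p 0 a 1 1) = complex.Re (p (pi / 2) a 0 0 + p (pi / 2) a 1 1).
  apply: (@continuous_nat_constant R (fun t => complex.Re (p t a 0 0 + p t a 1 1))).
  - by rewrite divr_ge0 // pi_ge0.
  - move=> x; apply/cvgrPdist_lt => e e0; near=> y; rewrite -raddfB.
    apply: le_lt_trans (Re_le_modc _) _; rewrite opprD addrACA.
    have h : nr (p x a - p y a) < e / 2 by near: y; apply: pc; rewrite divr_gt0.
    apply: le_lt_trans (modcD _ _) _.
    have := entry_le_nr (p x a) (p y a) 0 0; have := entry_le_nr (p x a) (p y a) 1 1; lra.
  - move=> t; have [|n ->] := @idempotent_mx2_trace _ (p t a).
      by have [pM _] := sp t; rewrite -[LHS]/(bmul (p t a) (p t a)) -pM aa.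
    by exists n; rewrite -(rmorph_nat (real_complex R)).
have q0 : q 0 = \matrix_(i, j) ((i == j) && (i == 0))%:R.
  apply/matrixP => i j; rewrite !mxE /w cos0 sin0.
  by case: i j => [[|[|//]] hi] [[|[|//]] hj] /=; rewrite ?mulr1 ?mulr0.
have q1 : q (pi / 2) = \matrix_(i, j) ((i == j) && (i != 0))%:R.
  apply/matrixP => i j; rewrite !mxE /w cos_pihalf sin_pihalf.
  by case: i j => [[|[|//]] hi] [[|[|//]] hj] /=; rewrite ?mulr1 ?mulr0.
have PtE0 v : Pt 0 v = \matrix_(i, j)
    ((i == j) && (if i == 0 then v \in (S :|: S')%SET else v \in finset.set0))%:R.
  apply/matrixP => i j; rewrite /Pt !mxE !inE.
  case: (v \in S); case: (v \in S') => /=; rewrite ?q0 ?mxE //;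
    by case: (i == 0); rewrite ?andbF.
have PtE1 v : Pt (pi / 2) v = \matrix_(i, j)
    ((i == j) && (if i == 0 then v \in S else v \in S'))%:R.
  apply/matrixP => i j; have := dis v; rewrite /Pt !mxE.
  case: (v \in S); case: (v \in S') => //=; first by move=> /(_ isT).
  - by rewrite q0 mxE; case: (i == 0).
  - by rewrite q1 mxE; case: (i == 0).
  - by rewrite mxE; case: (i == 0); rewrite andbF.
have zero : character (fun _ : A => 0 : R[i]) by split=> *; rewrite ?mulr0 ?addr0.
have [c0 cP0 cT0] := chiP (admissible0 finset.set0).
have chi0 : chi finset.set0 (fun=> 0) a = 0.
  by apply: (character_eq c0 zero) => [v|e]; rewrite ?cP0 ?cT0 // inE.
move: tE; rewrite (traceE _ _ _ PtE0) (traceE _ _ _ PtE1) chi0 addr0.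
have [b1 ->] := character_idempotent (admissible0 (S :|: S')%SET).
have [b2 ->] := character_idempotent (admissible0 S).
have [b3 ->] := character_idempotent (admissible0 S').
rewrite -natrD -!(rmorph_nat (real_complex R)) /= => /eqP; rewrite eqr_nat => /eqP -> //.
Unshelve. all: by end_near. Qed.

End Idempotent.

End UniversalCharacters.

(** * From algebra isomorphisms to multigraph isomorphisms *)

Lemma rV_continuous (R : realType) (X : topologicalType) n (h : X -> 'rV[R]_n) :
  (forall j x (e : R), 0 < e -> \forall y \near x, `|h x 0 j - h y 0 j| < e) ->
  continuous h.
Proof.
move=> hc x; apply/cvgrPdist_lt => e e0.
have hx : \forall y \near x, forall j, `|h x 0 j - h y 0 j| < e.
  by apply: filter_forall => j; exact: hc.
near=> y; apply/rV_norm_lt => // j; rewrite !mxE.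
by have hy : forall j, `|h x 0 j - h y 0 j| < e by near: y.
Unshelve. all: by end_near. Qed.

Definition induced_edges (Q : digraph) (S : {set vertex Q}) : {set edge Q} :=
  [set e | (range_map e \in S) && (source_map e \in S)]%SET.

Definition universal_family (R : realType) (Q : digraph) (A : cstarAlgType R)
    (P : vertex Q -> A) (T : edge Q -> A) : Prop :=
  [/\ graph_family P T, cstar_generated (range P `|` range T) &
    forall (B : cstarAlgType R) (P' : vertex Q -> B) (T' : edge Q -> B),
    graph_family P' T' -> exists f : {linear A -> B},
    [/\ star_morphism f, forall v, f (P v) = P' v & forall e, f (T e) = T' e]].

Definition algebra_hom (R : realType) (A B : banachAlgType R) (f : A -> B) : Prop :=
  (forall (c : R[i]) x y, f (c *: x + y) = c *: f x + f y) /\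
  {morph f : x y / bmul x y}.

(** The effect of the pullback chi |-> chi \o f on supports of characters, hence contravariant in f.
    It is read off at the centre of the polydisc. *)
Definition support_map (R : realType) (Q1 Q2 : digraph) (A1 A2 : cstarAlgType R)
    (P1 : vertex Q1 -> A1) (chi2 : {set vertex Q2} -> (edge Q2 -> R[i]) -> A2 -> R[i])
    (f : A1 -> A2) (S : {set vertex Q2}) : {set vertex Q1} :=
  [set v | chi2 S (fun=> 0) (f (P1 v)) == 1]%SET.

Section Transfer.
Variables (R : realType) (Q1 Q2 : digraph) (A1 A2 : cstarAlgType R).
Variables (P1 : vertex Q1 -> A1) (T1 : edge Q1 -> A1).
Variables (P2 : vertex Q2 -> A2) (T2 : edge Q2 -> A2).
Hypotheses (univ1 : universal_family P1 T1) (univ2 : universal_family P2 T2).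
Variables (chi1 : {set vertex Q1} -> (edge Q1 -> R[i]) -> A1 -> R[i]).
Variables (chi2 : {set vertex Q2} -> (edge Q2 -> R[i]) -> A2 -> R[i]).
Hypothesis chi1P : character_parametrization P1 T1 chi1.
Hypothesis chi2P : character_parametrization P2 T2 chi2.
Variable f : A1 -> A2.
Hypothesis f_hom : algebra_hom f.

Local Notation sigma := (support_map P1 chi2 f).

Lemma idempotent_image v : bmul (f (P1 v)) (f (P1 v)) = f (P1 v).
Proof. by have [[Pp _ _ _] _ _] := univ1; rewrite -(proj2 f_hom) (proj1 (Pp v)). Qed.

(** The idempotent [f (P1 v)] has a constant value on the polydisc of S, so the support of a
    pulled-back character depends on S alone. *)
Lemma support_map_value S z v : admissible S z ->
  chi2 S z (f (P1 v)) = (v \in sigma S)%:R.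
Proof.
move=> adm; have [_ gen2 uni2] := univ2.
rewrite (character_idempotent_constant gen2 uni2 chi2P (idempotent_image v) adm) inE.
have [b ->] := character_idempotent chi2P (idempotent_image v) (@admissible0 R Q2 S).
by case: b; rewrite ?eqxx // eq_sym oner_eq0.
Qed.

Lemma transfer_character S z : admissible S z ->
  admissible (sigma S) (fun e => chi2 S z (f (T1 e))) /\
  forall a, chi2 S z (f a) = chi1 (sigma S) (fun e => chi2 S z (f (T1 e))) a.
Proof.
move=> adm; have [[cL cM] _ _] := chi2P adm; have [fam1 gen1 _] := univ1.
have cc : character (fun a => chi2 S z (f a)).
  by split=> [c x y|x y]; rewrite ?(proj1 f_hom) ?(proj2 f_hom) ?cL ?cM.
have [adm1 _] := admissible_character fam1 cc.
have SE : [set v | chi2 S z (f (P1 v)) == 1]%SET = sigma S.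
  apply/setP => v; rewrite inE support_map_value //.
  by case: (v \in _); rewrite ?eqxx // eq_sym oner_eq0.
rewrite SE in adm1; split=> // a; have [c1 cP cT] := chi1P adm1.
by apply: (character_eq gen1 cc c1) => [v|e]; rewrite ?cP ?cT // support_map_value.
Qed.

(** Additivity holds for the indicator values; since their sum is again 0 or 1, the images are
    disjoint. *)
Lemma support_mapU (S S' : {set vertex Q2}) : (forall v, v \in S -> v \notin S') ->
  sigma (S :|: S')%SET = (sigma S :|: sigma S')%SET /\
  forall v, v \in sigma S -> v \notin sigma S'.
Proof.
move=> dis; have [_ gen2 uni2] := univ2.
have E v : ((v \in sigma (S :|: S')%SET : nat) = (v \in sigma S) + (v \in sigma S'))%N.
  have := character_idempotent_additive gen2 uni2 chi2P (idempotent_image v) dis.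
  rewrite !(support_map_value _ (@admissible0 R Q2 _)) -natrD => /eqP.
  by rewrite -!(rmorph_nat (real_complex R)) (inj_eq (@complexI R)) eqr_nat => /eqP.
split=> [|v vS].
  apply/setP => v; rewrite finset.in_setU; have := E v.
  by case: (v \in sigma _); case: (v \in sigma S); case: (v \in sigma S').
have := E v; rewrite vS; case: (v \in sigma S') => //.
by case: (v \in _).
Qed.

Variable g : A2 -> A1.
Hypothesis gK : cancel g f.

(** As f is onto, a character is determined by its pullback, and the pullback by its support and its
    values at the edges spanned there. *)
Lemma transfer_injective S z z' : admissible S z -> admissible S z' ->
  (forall e, e \in induced_edges (sigma S) ->
     chi2 S z (f (T1 e)) = chi2 S z' (f (T1 e))) ->
  z = z'.
Proof.
move=> adm adm' H; have [a1 E1] := transfer_character adm.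
have [a1' E1'] := transfer_character adm'.
have ww : (fun e => chi2 S z (f (T1 e))) = (fun e => chi2 S z' (f (T1 e))).
  apply/funext => e; have [/H //|eS] := boolP (e \in induced_edges (sigma S)).
  have out (w : edge Q1 -> R[i]) : admissible (sigma S) w -> w e = 0.
    move=> /(_ e)[_ wS]; apply/eqP; apply: contraT => /wS[re se].
    by move: eS; rewrite inE re se.
  by rewrite (out _ a1) (out _ a1').
have [_ _ cT] := chi2P adm; have [_ _ cT'] := chi2P adm'.
by apply/funext => e; rewrite -cT -cT' -(gK (T2 e)) E1 E1' ww.
Qed.

(** A real cube of dimension 2k sits in the polydisc of S, and the coordinates of the pulled-back
    characters inject it into R^(2l). *)
Lemma induced_edges_card_le S :
  (#|induced_edges S| <= #|induced_edges (sigma S)|)%N.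
Proof.
set k := #|induced_edges S|; set l := #|induced_edges (sigma S)|.
(* Clamping to [0, 1] defines the map on the whole space, as [invariance_of_dimension] demands, and
   changes nothing on the box. *)
pose cl (t : R) := Num.max 0 (Num.min t 1).
have cl01 t : 0 <= cl t <= 1.
  by rewrite /cl le_max lexx /= ge_max ler01 ge_min lexx orbT.
have clE t : 0 <= t <= 1 -> cl t = t.
  by move=> /andP[t0 t1]; rewrite /cl (min_idPl t1) (max_idPr t0).
have cl_dist s t : `|cl s - cl t| <= `|s - t|.
  have h1 := ler_norm (s - t); have h2 := ler_norm (t - s); rewrite distrC in h2.
  rewrite ler_norml /cl /Num.max /Num.min.
  by case: (ltP s 1) => s1; case: (ltP t 1) => t1; do ?case: ltP => ?; lra.
(* Halving both coordinates places the square inside the unit disc. *)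
pose zi (x : 'rV[R]_(k + k)) (i : 'I_k) : R[i] :=
  (cl (x 0 (lshift k i)) / 2) +i* (cl (x 0 (rshift k i)) / 2).
pose z (x : 'rV[R]_(k + k)) (e : edge Q2) : R[i] :=
  if insub (index e (enum (induced_edges S))) is Some i then zi x i else 0.
have adm x : admissible S (z x).
  move=> e; rewrite /z; case: insubP => [i|_]; last by rewrite modc0 ler01 eqxx.
  rewrite [in X in X -> _]/k cardE index_mem mem_enum inE => /andP[re se] _; split=> //.
  rewrite (le_trans (modc_le_ReIm _)) //= !ger0_norm ?divr_ge0 //.
  - by have /andP[_ h1] := cl01 (x 0 (lshift k i)); have /andP[_ h2] := cl01 (x 0 (rshift k i)); lra.
  - by case/andP: (cl01 (x 0 (rshift k i))).
  - by case/andP: (cl01 (x 0 (lshift k i))).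
have zE x i : z x (enum_val i) = zi x i.
  rewrite /z; have -> : index (enum_val i) (enum (induced_edges S)) = i.
    rewrite (enum_val_nth (enum_val i)) index_uniq ?enum_uniq // -cardE; exact: ltn_ord.
  by rewrite valK.
have z_cont i (x : 'rV[R]_(k + k)) (e : R) : 0 < e -> \forall y \near x, modc (z x i - z y i) < e.
  move=> e0; rewrite /z; case: insubP => [j _ _|_]; last first.
    by near=> y; rewrite subrr modc0.
  have co (c : 'I_(k + k)) : \forall y \near x, `|x 0 c - (y : 'rV[R]_(k + k)) 0 c| < e.
    by have /cvgrPdist_lt/(_ e e0) := @coord_continuous R 1 (k + k) 0 c x.
  near=> y; rewrite (le_lt_trans (modc_le_ReIm _)) //=.
  have h1 : `|x 0 (lshift k j) - y 0 (lshift k j)| < e by near: y; exact: co.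
  have h2 : `|x 0 (rshift k j) - y 0 (rshift k j)| < e by near: y; exact: co.
  have := cl_dist (x 0 (lshift k j)) (y 0 (lshift k j)).
  have := cl_dist (x 0 (rshift k j)) (y 0 (rshift k j)).
  rewrite -!mulrBl !normrM [ `|2^-1|]ger0_norm //; lra.
pose w x (e : edge Q1) := chi2 S (z x) (f (T1 e)).
pose h (x : 'rV[R]_(k + k)) : 'rV[R]_(l + l) := \row_(j < l + l)
  match fintype.split j with
  | inl i => complex.Re (w x (enum_val i))
  | inr i => complex.Im (w x (enum_val i))
  end.
have w_cont e (x : 'rV[R]_(k + k)) (d : R) : 0 < d -> \forall y \near x, modc (w x e - w y e) < d.
  have [_ gen2 uni2] := univ2.
  exact: (character_continuous gen2 uni2 chi2P adm z_cont).
suff : (k + k <= l + l)%N by rewrite !addnn leq_double.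
apply: (@invariance_of_dimension R (k + k) (l + l) h).
- apply: rV_continuous => j x e e0.
  case ji : (fintype.split j) => [i|i]; near=> y; rewrite !mxE ji -raddfB.
    by apply: le_lt_trans (Re_le_modc _) _; near: y; exact: w_cont.
  by apply: le_lt_trans (Im_le_modc _) _; near: y; exact: w_cont.
move=> x y bx bY /rowP hxy.
have zz : z x = z y.
  apply: (transfer_injective (adm x) (adm y)) => e eS.
  rewrite -[LHS]/(w x e) -[RHS]/(w y e) -(enum_rankK_in eS eS).
  set i := enum_rank_in _ _.
  have := hxy (lshift l i); have := hxy (rshift l i).
  rewrite !mxE (unsplitK (inl i)) (unsplitK (inr i)).
  by case: (w x _) => a b; case: (w y _) => c d /= -> ->.
have zi_eq i : zi x i = zi y i by rewrite -!zE zz.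
apply/rowP => j; rewrite -[j]splitK; case: (fintype.split j) => i /=; case: (zi_eq i).
  move=> + _; have := bx (lshift k i); have := bY (lshift k i); rewrite /= !in_itv /= => b1 b2.
  by rewrite !clE //; lra.
move=> _; have := bx (rshift k i); have := bY (rshift k i); rewrite /= !in_itv /= => b1 b2.
by rewrite !clE //; lra.
Unshelve. all: by end_near. Qed.

End Transfer.

Lemma support_mapK (R : realType) (Q1 Q2 : digraph) (A1 A2 : cstarAlgType R)
    (P1 : vertex Q1 -> A1) (T1 : edge Q1 -> A1) (P2 : vertex Q2 -> A2) (T2 : edge Q2 -> A2)
    chi1 chi2 (f : A1 -> A2) (g : A2 -> A1) :
  universal_family P1 T1 -> universal_family P2 T2 ->
  character_parametrization P1 T1 chi1 -> character_parametrization P2 T2 chi2 ->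
  algebra_hom f -> algebra_hom g -> cancel g f ->
  cancel (support_map P1 chi2 f) (support_map P2 chi1 g).
Proof.
move=> u1 u2 c1 c2 hf hg gK S; apply/setP => v.
have adm := @admissible0 R Q2 S.
have [adm1 E] := transfer_character u1 u2 c1 c2 hf adm.
have := support_map_value u2 u1 c1 hg v adm1; rewrite -E gK.
have [_ -> _] := c2 _ _ adm.
by move/eqP; rewrite eqr_nat; do 2! case: (_ \in _).
Qed.

(** * Power-set bijections additive on disjoint unions *)

Section SetBijections.
Variables (V1 V2 : finType) (s : {set V2} -> {set V1}) (t : {set V1} -> {set V2}).
Hypotheses (sK : cancel s t) (tK : cancel t s).
Hypothesis sU : forall S S' : {set V2}, (forall v, v \in S -> v \notin S') ->
  s (S :|: S')%SET = (s S :|: s S')%SET /\ forall v, v \in s S -> v \notin s S'.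

(** The empty set is disjoint from itself, hence so is its image. *)
Lemma additive_bijection0 : s finset.set0 = finset.set0.
Proof.
have [|_ h] := sU (S := finset.set0) (S' := finset.set0); first by move=> v; rewrite inE.
by apply/setP => v; rewrite [RHS]inE; apply/negP => /[dup] /h /negP.
Qed.

(** Pick w in t {v} and split it off: {v} is the union of s {w} and the image of the rest. As s {w}
    is nonempty, it is all of {v}. *)
Lemma additive_bijection1 v : exists w, t [set v]%SET = [set w]%SET.
Proof.
have [t0|[w wt]] := set_0Vmem (t [set v]%SET).
  have := tK [set v]%SET; rewrite t0 additive_bijection0 => /setP/(_ v).
  by rewrite !inE eqxx.
exists w; have [|U D] := sU (S := [set w]%SET) (S' := t [set v] :\ w)%SET.
  by move=> x; rewrite !inE => ->.
rewrite (finset.setD1K wt) tK in U.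
have [s0|[x xs]] := set_0Vmem (s [set w]%SET).
  have := sK [set w]%SET; rewrite s0 -additive_bijection0 sK => /setP/(_ w).
  by rewrite !inE eqxx.
suff -> : [set v]%SET = s [set w]%SET by rewrite sK.
have : x \in [set v]%SET by rewrite U inE xs.
rewrite inE => /eqP xv; apply/eqP; rewrite finset.eqEsubset finset.sub1set -xv xs /=.
by have := finset.subsetUl (s [set w]%SET) (s (t [set v] :\ w)%SET); rewrite -U xv.
Qed.

End SetBijections.

Section Edges.
Variable Q : digraph.
Implicit Types v w : vertex Q.

Lemma edges_between_loop v :
  edges_between [set v; v]%SET = #|induced_edges [set v]%SET|.
Proof.
apply: eq_card => e; rewrite !inE finset.setUid; apply/eqP/andP => [/setP E|[/eqP-> /eqP->]].
  by have := E (range_map e); have := E (source_map e); rewrite !inE !eqxx orbT => <- <-.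
by rewrite finset.setUid.
Qed.

Lemma edges_between_distinct v w : v != w ->
  #|induced_edges [set v; w]%SET| = (edges_between [set v; w]%SET +
    #|induced_edges [set v]%SET| + #|induced_edges [set w]%SET|)%N.
Proof.
move=> vw; have cardE (A : {set edge Q}) : #|A| = \sum_e (e \in A : nat).
  by rewrite -sum1_card big_mkcond; apply: eq_bigr => e _; case: (_ \in _).
rewrite /edges_between !cardE -!big_split; apply: eq_bigr => e _.
rewrite !inE; set r := range_map e; set u := source_map e.
have -> : ([set r; u] == [set v; w])%SET = ((r == v) && (u == w) || (r == w) && (u == v)).
  apply/eqP/orP => [/setP E|[|] /andP[/eqP-> /eqP->] //]; last by rewrite finset.setUC.
  have := E r; have := E u; have := E v; have := E w; rewrite !inE !eqxx orbT /=.
  rewrite (eq_sym v r) (eq_sym v u) (eq_sym w r) (eq_sym w u).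
  have : ~~ ((r == v) && (r == w)) by apply/negP => /andP[/eqP-> vw']; rewrite vw' in vw.
  by case: (r == v); case: (r == w); case: (u == v); case: (u == w) => //=; auto.
have : ~~ ((r == v) && (r == w)) by apply/negP => /andP[/eqP-> vw']; rewrite vw' in vw.
have : ~~ ((u == v) && (u == w)) by apply/negP => /andP[/eqP-> vw']; rewrite vw' in vw.
by case: (r == v); case: (r == w); case: (u == v); case: (u == w).
Qed.

End Edges.

Lemma multigraph_isomorphic_of_banach (R : realType) (Q1 Q2 : digraph)
    (A1 A2 : cstarAlgType R) : is_GCm Q1 A1 -> is_GCm Q2 A2 ->
  banach_isomorphic A1 A2 -> multigraph_isomorphic (undirected Q1) (undirected Q2).
Proof.
move=> [P1 [T1 [fam1 gen1 uni1]]] [P2 [T2 [fam2 gen2 uni2]]] [f [g [fM fK gK _ _]]].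
have u1 : universal_family P1 T1 by split.
have u2 : universal_family P2 T2 by split.
have hf : algebra_hom f by split=> // c x y; rewrite linearP.
have hg : algebra_hom g.
  split=> [c x y|x y].
    by rewrite -{1}(gK x) -{1}(gK y) -linearP fK.
  by rewrite -{1}(gK x) -{1}(gK y) -fM fK.
have [p1 [c1 _]] := parametrized_representation gen1 uni1.
have [p2 [c2 _]] := parametrized_representation gen2 uni2.
set chi1 := fun S z a => _ in c1; set chi2 := fun S z a => _ in c2.
pose s := support_map P1 chi2 f; pose t := support_map P2 chi1 g.
have sK : cancel s t := support_mapK u1 u2 c1 c2 hf hg gK.
have tK : cancel t s := support_mapK u2 u1 c2 c1 hg hf fK.
have sU := support_mapU u1 u2 c2 hf; have tU := support_mapU u2 u1 c1 hg.
have [phi phiE] := choice (additive_bijection1 sK tK sU).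
have [psi psiE] := choice (additive_bijection1 tK sK tU).
have phiK : cancel phi psi.
  by move=> v; apply/finset.set1_inj; rewrite -psiE -phiE tK.
have psiK : cancel psi phi.
  by move=> v; apply/finset.set1_inj; rewrite -phiE -psiE sK.
have card S : #|induced_edges S| = #|induced_edges (t S)|.
  apply/eqP; rewrite eqn_leq (induced_edges_card_le u2 u1 c2 c1 hg fK) /=.
  by rewrite -{2}(tK S) (induced_edges_card_le u1 u2 c1 c2 hf gK).
exists phi; first by exists psi.
move=> v w /=; have [<-|vw] := eqVneq v w.
  by rewrite !edges_between_loop card phiE.
have fvw : phi v != phi w by rewrite (can_eq phiK).
have := edges_between_distinct vw; have := edges_between_distinct fvw.
have [|tvw _] := tU [set v]%SET [set w]%SET; first by move=> x; rewrite !inE => /eqP ->.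
rewrite (card [set v; w]%SET) (card [set v]%SET) (card [set w]%SET) !phiE.
move: tvw; rewrite -/t => ->; rewrite !phiE; lia.
Qed.

Theorem theorem2 (R : realType) (Q1 Q2 : digraph) (A1 A2 : cstarAlgType R)
    (univ1 : is_GCm Q1 A1) (univ2 : is_GCm Q2 A2) :
  banach_isomorphic A1 A2 <->
  multigraph_isomorphic (undirected Q1) (undirected Q2).
Proof.
split; first exact: multigraph_isomorphic_of_banach.
exact: banach_isomorphic_of_multigraph.
Qed.
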